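(* Let $\kappa>0$ and let $\mathcal{T}_h$ be a mesh whose elements satisfy $K\subset B(x_K,h_K)$. Suppose that on every $K\in\mathcal{T}_h$ $$u|_K=\sum_{j=1}^{q_K}c_{Kj}\,\psi^K_{z_{Kj}},\qquad |\operatorname{Im}z_{Kj}|\le\eta_{\max},$$ and let recovered angles $\widehat z_{Kj}$ ($1\le j\le q_K$) lie in the same strip, $|\operatorname{Im}\widehat z_{Kj}|\le\eta_{\max}$. Set $$\delta_K^2=\sum_{j=1}^{q_K}|\widehat z_{Kj}-z_{Kj}|^2,\qquad c_K=(c_{K1},\ldots,c_{Kq_K}).$$ If the broken Trefftz space $V_h(\widehat Z)$ contains the corresponding recovered plane waves (i.e. for every $K$ and $j$, the function equal to $\psi^K_{\widehat z_{Kj}}$ on $K$ and $0$ on the other elements), then $$\inf_{v_h\in V_h(\widehat Z)}\Big(\sum_K\|u-v_h\|_{H^1(K)}^2\Big)^{1/2}\le\Big(\sum_KC_{H^1,K}^2\|c_K\|_2^2\,\delta_K^2\Big)^{1/2},$$ $$\inf_{v_h\in V_h(\widehat Z)}\Big(\sum_K\|u-v_h\|_{\mathrm{tr},K}^2\Big)^{1/2}\le\Big(\sum_KC_{\mathrm{tr},K}^2\|c_K\|_2^2\,\delta_K^2\Big)^{1/2}.$$ If, in addition, the PWDG quasi-optimality estimate $$\|u-u_h\|_{\mathrm{DG}}\le C_{\mathrm{qo}}\inf_{v_h\in V_h(\widehat Z)}\|u-v_h\|_{\mathrm{DG}+}$$ holds for the fixed flux configuration, where $u_h=u_h(\widehat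 Z)\in V_h(\widehat Z)$ is the PWDG solution, then $$\|u-u_h(\widehat Z)\|_{\mathrm{DG}}\le C_{\mathrm{qo}}\,C_{\mathrm{face}}^{1/2}\Big(\sum_KC_{\partial,K}^2\|c_K\|_2^2\,\delta_K^2\Big)^{1/2}.$$
   Context: Local functions and norms. $\psi_z^K(x)=e^{i\kappa d(z)\cdot(x-x_K)}$, $d(z)=(\cos z,\sin z)\in\mathbb{C}^2$, bilinear dot product. $\|v\|_{\mathrm{tr},K}^2=\int_{\partial B(x_K,h_K)}(\kappa|v|^2+\kappa^{-1}|\partial_nv|^2)\,ds$, applied to the analytic continuation of $v|_K$ (the functions involved are, on each $K$, finite combinations of plane waves and Fourier--Bessel modes $J_m(\kappa\rho)e^{im\psi}$ centred at $x_K$, hence entire). $\|v\|_{\partial K,+}^2=\int_{\partial K}(\kappa|v|^2+\kappa^{-1}|\nabla v|^2)\,ds$. $\|v\|_{H^1(K)}^2=\|v\|_{L^2(K)}^2+\|\nabla v\|_{L^2(K)}^2$. Constants. With $D_\eta=\sqrt{\cosh(2\eta_{\max})}$, $E_K=e^{\kappa h_K\sinh\eta_{\max}}$, and $P_K=(1+\kappa h_KD_\eta)^2$: $C_{H^1,K}=|K|^{1/2}\kappa D_\eta E_K(h_K^2+P_K)^{1/2}$, $C_{\mathrm{tr},K}=(2\pi h_K\kappa D_\eta^2E_K^2[(\kappa h_K)^2+P_K])^{1/2}$, $C_{\partial,K}=(|\partial K|\kappa D_\eta^2E_K^2[(\kappa h_K)^2+P_K])^{1/2}$. PWDG setting. $\mathcal{T}_h$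 is a shape-regular mesh of $\Omega\subset\mathbb{R}^2$, with interior faces $\mathcal{F}_h^{\mathrm I}$ and boundary split into a Dirichlet part $\Gamma_D$, an impedance part $\Gamma_A$, and possibly a circle $\Gamma_R$ of radius $R$ carrying a truncated DtN condition (each possibly empty). $V_h(\widehat Z)$ is a finite-dimensional subspace of $T(\mathcal{T}_h)=\{v\in H^1(\mathcal{T}_h):\Delta v+\kappa^2v=0\text{ in every }K\}$. On a face $F=\partial K^+\cap\partial K^-$ with outward normals $n^\pm$: $\{v\}=\frac12(v^++v^-)$ (same for $\nabla v$), $[v]=v^+n^++v^-n^-$, $[\nabla v]=\nabla v^+\cdot n^++\nabla v^-\cdot n^-$. With fixed flux parameters $\alpha,\beta>0$, $0<\delta<1$, $$\begin{aligned}\mathscr{A}_h(u,v)={}&\int_{\mathcal{F}_h^{\mathrm I}}\Big(\{u\}\overline{[\nabla v]}-\{\nabla u\}\cdot\overline{[v]}-\alpha i\kappa[u]\cdot\overline{[v]}+\tfrac{\beta}{i\kappa}[\nabla u]\overline{[\nabla v]}\Big)ds+\int_{\Gamma_D}\big(-\partial_nu\,\overline v-\alpha i\kappa u\overline v\big)ds\\&+\int_{\Gamma_A}\Big((1-\delta)u\,\overline{\partial_nv}-\delta\,\partial_nu\,\overline v-i(1-\delta)\kappa u\overline v+\tfrac{\delta}{i\kappa}\partial_nu\,\overline{\partial_nv}\Big)ds+\mathscr{A}_R(u,v),\end{aligned}$$ where $\mathscr{A}_R(u,v)=\int_{\Gamma_R}\big[u\,\overline{\partial_nv}-(\mathrm{DtN}_Nu)\overline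 v+\frac{\delta}{i\kappa}(\partial_nu-\mathrm{DtN}_Nu)\overline{(\partial_nv-\mathrm{DtN}_Nv)}\big]ds$ (absent if $\Gamma_R=\varnothing$) and $\mathrm{DtN}_Nv=\sum_{|m|\le N}\kappa\frac{H_m^{(1)\prime}(\kappa R)}{H_m^{(1)}(\kappa R)}v_me^{im\theta}$, $v_m$ being the Fourier coefficients of $v|_{\Gamma_R}$. The PWDG solution $u_h\in V_h(\widehat Z)$ satisfies $\mathscr{A}_h(u_h,v_h)=\ell_h(v_h)$ for all $v_h\in V_h(\widehat Z)$, where $\ell_h$ is the load functional of the method; for data $u=g_D$ on $\Gamma_D$, $\partial_nu-i\kappa u=g_A$ on $\Gamma_A$ it is $\ell_h(v)=-\int_{\Gamma_D}g_D(\overline{\partial_nv}+\alpha i\kappa\overline v)ds+\int_{\Gamma_A}((1-\delta)g_A\overline v+\frac{\delta}{i\kappa}g_A\overline{\partial_nv})ds$ (plus the corresponding data term on $\Gamma_R$). DG norms, for piecewise Trefftz $v$: $\|v\|_{\mathrm{DG}}^2=-\operatorname{Im}\mathscr{A}_h(v,v)$ and $$\|v\|_{\mathrm{DG}+}^2=-\operatorname{Im}\mathscr{A}_h(v,v)+\kappa^{-1}\|\{\nabla v\}\|_{0,\mathcal{F}_h^{\mathrm I}}^2+\kappa\|\{v\}\|_{0,\mathcal{F}_h^{\mathrm I}}^2+\kappa^{-1}\|\partial_nv\|_{0,\Gamma_D}^2,$$ plus, when $\Gamma_R\neq\varnothing$, a fixed nonnegative quadratic form in the Cauchy data of $v$ on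 $\Gamma_R$ (the finite-dimensional DtN trace terms). $C_{\mathrm{face}}$ denotes a constant for which $$\|v\|_{\mathrm{DG}+}^2\le C_{\mathrm{face}}\sum_{K\in\mathcal{T}_h}\|v\|_{\partial K,+}^2$$ holds for all piecewise Trefftz $v$ with square-integrable Cauchy traces; it depends only on the flux parameters and face multiplicity, and, for a fixed truncated DtN map, also on its finite-dimensional trace-operator bound. *)

(* Defs.v *)
From HB Require Import structures.
From mathcomp Require Import all_boot all_order all_algebra complex.
From mathcomp Require Import all_classical all_reals all_analysis.

Set Implicit Arguments.
Unset Strict Implicit.
Unset Printing Implicit Defensive.

Import Order.TTheory GRing.Theory Num.Theory.
Import numFieldNormedType.Exports.

Local Open Scope classical_set_scope.
Local Open Scope ring_scope.
Local Open Scope complex_scope.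

Section Scalars.
Context {R : realType}.
Implicit Types (x y : R * R) (z : R[i]).

Definition cosh (t : R) : R := (expR t + expR (- t)) / 2.
Definition sinh (t : R) : R := (expR t - expR (- t)) / 2.

Definition iC : R[i] := 0 +i* 1.

Definition abs2 z : R := complex.Re z ^+ 2 + complex.Im z ^+ 2.
Definition cabs z : R := Num.sqrt (abs2 z).

Definition l2_sq (n : nat) (a : 'I_n -> R[i]) : R := \sum_(j < n) abs2 (a j).

Definition cexp z : R[i] :=
  (expR (complex.Re z) * cos (complex.Im z)) +i*
  (expR (complex.Re z) * sin (complex.Im z)).
Definition ccos z : R[i] := (cexp (iC * z) + cexp (- (iC * z))) / 2.
Definition csin z : R[i] := (cexp (iC * z) - cexp (- (iC * z))) / (2 * iC).

(* The library norm on R * R is the sup norm; the mesh geometry is Euclidean. *)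
Definition enorm x : R := Num.sqrt (x.1 ^+ 2 + x.2 ^+ 2).
Definition disc x (r : R) : set (R * R) := [set y | enorm (y - x) < r].

Definition cvec x : R[i] * R[i] := (x.1%:C, x.2%:C).
Definition cdot (a b : R[i] * R[i]) : R[i] := a.1 * b.1 + a.2 * b.2.
Definition cconj2 (a : R[i] * R[i]) : R[i] * R[i] := (conjc a.1, conjc a.2).
Definition vabs2 (a : R[i] * R[i]) : R := abs2 a.1 + abs2 a.2.

Definition lebesgue2 := (@lebesgue_measure R \x @lebesgue_measure R)%E.

Definition dir (b : bool) : R * R := if b then (0, 1) else (1, 0).

Definition pd (b : bool) (f : R * R -> R[i]) x : R[i] :=
  ('D_(dir b) (fun y => complex.Re (f y)) x) +i*
  ('D_(dir b) (fun y => complex.Im (f y)) x).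

Definition grad (f : R * R -> R[i]) x : R[i] * R[i] :=
  (pd false f x, pd true f x).

Definition laplacian (f : R * R -> R[i]) x : R[i] :=
  pd false (pd false f) x + pd true (pd true f) x.

Definition C2_on (U : set (R * R)) (f : R * R -> R) : Prop :=
  forall x, U x -> forall a b : bool,
    [/\ derivable f x (dir a),
        {for x, continuous ('D_(dir a) f : R * R -> R)},
        derivable ('D_(dir a) f : R * R -> R) x (dir b) &
        {for x, continuous ('D_(dir b) ('D_(dir a) f) : R * R -> R)}].

(* Integral representations of the Bessel functions of integer order m, valid
   for every integer m and, as regards Y, for t > 0. *)
Definition besselJ (m : int) (t : R) : R :=
  pi^-1 * \int[@lebesgue_measure R]_(s in `[0, pi]) cos (m%:~R * s - t * sin s).
Definition besselY (m : int) (t : R) : R :=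
  pi^-1 * \int[@lebesgue_measure R]_(s in `[0, pi]) sin (t * sin s - m%:~R * s)
  - pi^-1 * \int[@lebesgue_measure R]_(s in `[0, +oo[)
      ((expR (m%:~R * s) + (-1) ^ m * expR (- (m%:~R * s)))
       * expR (- (t * sinh s))).

Definition hankel1 (m : int) (t : R) : R[i] := besselJ m t +i* besselY m t.
Definition dhankel1 (m : int) (t : R) : R[i] :=
  (derive1 (besselJ m) t) +i* (derive1 (besselY m) t).

Definition planewave (kappa : R) (x0 : R * R) z x : R[i] :=
  cexp (iC * kappa%:C * cdot (ccos z, csin z) (cvec (x - x0))).

(* J_m(kappa rho) e^(i m psi) in polar coordinates about x0; at x = x0 the
   angular factor is 0 ^ m, which is harmless as J_m(0) = 0 for m <> 0. *)
Definition fourier_bessel (kappa : R) (x0 : R * R) (m : int) x : R[i] :=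
  let rho := enorm (x - x0) in
  (besselJ m (kappa * rho))%:C * (((x - x0).1 +i* (x - x0).2) / rho%:C) ^ m.

Definition local_combination (kappa : R) (x0 : R * R) (f : R * R -> R[i]) :=
  exists (n p : nat) (a z : 'I_n -> R[i]) (b : 'I_p -> R[i]) (m : 'I_p -> int),
    forall x, f x = \sum_(i < n) a i * planewave kappa x0 (z i) x
                  + \sum_(i < p) b i * fourier_bessel kappa x0 (m i) x.

Definition vel (g : R -> R * R) (t : R) : R * R :=
  (derive1 (fun s => (g s).1) t, derive1 (fun s => (g s).2) t).
Definition speed (g : R -> R * R) (t : R) : R := enorm (vel g t).
(* The unit normal on the right of the direction of travel. *)
Definition normal (g : R -> R * R) (t : R) : R * R :=
  ((vel g t).2 / speed g t, - (vel g t).1 / speed g t).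

(* Line integrals over an arc g : [0, 1] -> R^2 of a function of the parameter. *)
Definition arc_int (g : R -> R * R) (f : R -> R) : R :=
  \int[@lebesgue_measure R]_(t in `[0, 1]) (f t * speed g t).
Definition carc_int (g : R -> R * R) (f : R -> R[i]) : R[i] :=
  arc_int g (fun t => complex.Re (f t)) +i* arc_int g (fun t => complex.Im (f t)).

Definition L2_arc (g : R -> R * R) (f : R -> R[i]) : Prop :=
  [/\ measurable_fun (`[0, 1] : set R) (fun t : R => complex.Re (f t) : R),
      measurable_fun (`[0, 1] : set R) (fun t : R => complex.Im (f t) : R) &
      (@lebesgue_measure R).-integrable `[0, 1]
        (EFin \o (fun t => abs2 (f t) * speed g t))].

End Scalars.

Variant bkind := Dirichlet | Impedance | Truncated.

(* Elements are open; faces are C^1 arcs, possibly curved, parametrized over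
   [0, 1] (by maps that are C^1 on the whole line, so that no one-sided
   derivatives are needed) and oriented so that [normal] points out of
   [plus F]. [nbr F] is the element on the other side of an interior face, and
   the type of boundary condition on a boundary face. *)
Record mesh (R : realType) := Mesh {
  elt : finType;
  face : finType;
  dom : set (R * R);
  elem : elt -> set (R * R);
  curve : face -> R -> R * R;
  plus : face -> elt;
  nbr : face -> elt + bkind;
  cR : R * R;
  rR : R;
  shape : R;

  incident (F : face) (K : elt) : bool :=
    (plus F == K) || (if nbr F is inl K' then K' == K else false);
  truncated (F : face) : bool := if nbr F is inr Truncated then true else false;

  dom_open : open dom;
  dom_bounded : exists r, dom `<=` disc 0 r;
  elem_open : forall K, open (elem K);
  elem_connected : forall K, connected (elem K);
  elem_dom : forall K, elem K `<=` dom;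
  elem_disjoint : forall K K', K <> K' -> elem K `&` elem K' = set0;
  elem_cover : closure dom = \bigcup_(K in [set: elt]) closure (elem K);
  elem_shape : forall K, exists x r, [/\ 0 < r, disc x r `<=` elem K &
    forall y y', elem K y -> elem K y' -> enorm (y - y') <= shape * r];

  curve_C1 : forall F t,
    [/\ derivable (fun s => (curve F s).1) t 1,
        derivable (fun s => (curve F s).2) t 1,
        {for t, continuous (derive1 (fun s => (curve F s).1))} &
        {for t, continuous (derive1 (fun s => (curve F s).2))}];
  curve_regular : forall F t, 0 <= t <= 1 -> speed (curve F) t != 0;
  curve_simple : forall F s t, 0 < s < 1 -> 0 <= t <= 1 ->
    curve F s = curve F t -> s = t;
  curve_disjoint : forall F F' s t, F <> F' -> 0 < s < 1 -> 0 <= t <= 1 ->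
    curve F s <> curve F' t;

  nbr_neq : forall F, nbr F <> inl (plus F);
  elem_boundary : forall K, closure (elem K) `\` elem K =
    \bigcup_(F in [set F | incident F K]) (curve F @` `[0, 1]);
  dom_boundary : closure dom `\` dom =
    \bigcup_(F in [set F | if nbr F is inr _ then true else false])
      (curve F @` `[0, 1]);
  interior_dom : forall F K t, nbr F = inl K -> 0 < t < 1 -> dom (curve F t);
  normal_outward : forall F t, 0 < t < 1 -> \forall s \near 0^'+,
    elem (plus F) (curve F t - s *: normal (curve F) t) /\
    match nbr F with
    | inl K => elem K (curve F t + s *: normal (curve F) t)
    | inr _ => ~ closure dom (curve F t + s *: normal (curve F) t)
    end;

  truncation_circle : (exists F, truncated F) ->
    [/\ 0 < rR, dom `<=` disc cR rR &
        \bigcup_(F in [set F | truncated F]) (curve F @` `[0, 1]) =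
        [set x | enorm (x - cR) = rR]]
}.

Section PWDG.
Context {R : realType} (M : mesh R).
Implicit Types (K : elt M) (F : face M).

(* A broken function is a family indexed by the elements; v K stands for the
   restriction to K or, when that has an entire continuation, for the
   continuation, so that its values and gradients on the boundary of K are the
   traces from K. *)
Definition broken := elt M -> R * R -> R[i].

Definition bsub (u v : broken) : broken := fun K x => u K x - v K x.

(* Boundary data: for each K, a trace and a gradient trace on the boundary. *)
Definition cauchy_data := elt M -> R * R -> R[i] * (R[i] * R[i]).

Definition jet (v : broken) : cauchy_data := fun K x => (v K x, grad (v K) x).

Definition area K : R := fine (lebesgue2 (elem K)).
Definition bd_int K (f : R * R -> R) : R :=
  \sum_(F : face M | incident F K) arc_int (curve F) (fun t => f (curve F t)).
Definition perimeter K : R := bd_int K (fun _ => 1).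

Definition H1_sq K (v : R * R -> R[i]) : R :=
  \int[lebesgue2]_(x in elem K) abs2 (v x)
  + \int[lebesgue2]_(x in elem K) vabs2 (grad v x).

Definition tr_sq (kappa : R) (x0 : R * R) (h : R) (v : R * R -> R[i]) : R :=
  \int[@lebesgue_measure R]_(t in `[0, 2 * pi])
    (let n := (cos t, sin t) in let x := x0 + h *: n in
     (kappa * abs2 (v x) + kappa^-1 * abs2 (cdot (grad v x) (cvec n))) * h).

Definition bd_sq (kappa : R) K (w : cauchy_data) : R :=
  bd_int K (fun x => kappa * abs2 (w K x).1 + kappa^-1 * vabs2 (w K x).2).

(* H^1 solutions of the Helmholtz equation are smooth inside K, so the equation
   is read classically. *)
Definition trefftz (kappa : R) (v : broken) : Prop := forall K,
  [/\ C2_on (elem K) (fun x => complex.Re (v K x)),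
      C2_on (elem K) (fun x => complex.Im (v K x)),
      forall x, elem K x -> laplacian (v K) x + (kappa ^+ 2)%:C * v K x = 0 &
      lebesgue2.-integrable (elem K)
        (EFin \o (fun x => abs2 (v K x) + vabs2 (grad (v K) x)))].

Definition L2_cauchy (w : cauchy_data) : Prop := forall K F, incident F K ->
  [/\ L2_arc (curve F) (fun t => (w K (curve F t)).1),
      L2_arc (curve F) (fun t => (w K (curve F t)).2.1) &
      L2_arc (curve F) (fun t => (w K (curve F t)).2.2)].

Definition approach (A : set (R * R)) (a : R) (x : R * R) : set (R * R) :=
  [set y | A y /\ disc y (a * enorm (y - x)) `<=` A].

(* w is the square-integrable Cauchy data of v: nontangential limits almost
   everywhere, with a square-integrable nontangential maximal function. *)
Definition cauchy_trace (v : broken) (w : cauchy_data) : Prop :=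
  L2_cauchy w /\
  forall a : R, 0 < a -> exists2 H : R * R -> R,
    (forall K F, incident F K -> L2_arc (curve F) (fun t => (H (curve F t))%:C)) &
    forall K F, incident F K ->
      {ae (@lebesgue_measure R), forall t, 0 <= t <= 1 ->
        let x := curve F t in let A := approach (elem K) a x in
        [/\ forall y, A y -> cabs (v K y) + Num.sqrt (vabs2 (grad (v K) y)) <= H x,
            cabs (v K y - (w K x).1) @[y --> within A (nbhs x)] --> (0 : R) &
            Num.sqrt (vabs2 ((grad (v K) y) - (w K x).2))
              @[y --> within A (nbhs x)] --> (0 : R)]}.

Definition nrm F (t : R) : R[i] * R[i] := cvec (normal (curve F) t).

Definition trace F (w : cauchy_data) (t : R) : R[i] := (w (plus F) (curve F t)).1.
Definition ntrace F (w : cauchy_data) (t : R) : R[i] :=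
  cdot (w (plus F) (curve F t)).2 (nrm F t).

(* Averages and jumps on an interior face F between plus F and K. *)
Definition avg F K (w : cauchy_data) (t : R) : R[i] :=
  ((w (plus F) (curve F t)).1 + (w K (curve F t)).1) / 2.
Definition gavg F K (w : cauchy_data) (t : R) : R[i] * R[i] :=
  let gp := (w (plus F) (curve F t)).2 in let gm := (w K (curve F t)).2 in
  ((gp.1 + gm.1) / 2, (gp.2 + gm.2) / 2).
Definition jump F K (w : cauchy_data) (t : R) : R[i] * R[i] :=
  let vp := (w (plus F) (curve F t)).1 in let vm := (w K (curve F t)).1 in
  let n := nrm F t in
  (vp * n.1 + vm * (- n.1), vp * n.2 + vm * (- n.2)).
Definition gjump F K (w : cauchy_data) (t : R) : R[i] :=
  cdot (w (plus F) (curve F t)).2 (nrm F t)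
  + cdot (w K (curve F t)).2 (- nrm F t).

(* e^(i theta) at a point of the truncation circle. *)
Definition circ (x : R * R) : R[i] :=
  ((x - cR M).1 +i* (x - cR M).2) / (rR M)%:C.

Definition fourier (w : cauchy_data) (m : int) : R[i] :=
  ((2 * pi * rR M)^-1)%:C *
  \sum_(F : face M | truncated F)
    carc_int (curve F) (fun t => trace F w t * circ (curve F t) ^ (- m)).

Definition dtn (kappa : R) (N : nat) (w : cauchy_data) (x : R * R) : R[i] :=
  \sum_(j < (2 * N).+1)
    (let m := j%:Z - N%:Z in
     kappa%:C * (dhankel1 m (kappa * rR M) / hankel1 m (kappa * rR M))
     * fourier w m * circ x ^ m).

Record flux := Flux {
  fl_alpha : R;
  fl_beta : R;
  fl_delta : R;
  fl_N : nat }.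

Definition flux_ok (p : flux) : Prop :=
  [/\ 0 < fl_alpha p, 0 < fl_beta p & 0 < fl_delta p < 1].

Section Forms.
Variables (kappa : R) (p : flux).
Let k : R[i] := kappa%:C.
Let alpha : R[i] := (fl_alpha p)%:C.
Let beta : R[i] := (fl_beta p)%:C.
Let delta : R[i] := (fl_delta p)%:C.

Definition A_integrand (u v : cauchy_data) F (t : R) : R[i] :=
  let D w := dtn kappa (fl_N p) w (curve F t) in
  match nbr F with
  | inl K =>
      avg F K u t * conjc (gjump F K v t)
      - cdot (gavg F K u t) (cconj2 (jump F K v t))
      - alpha * iC * k * cdot (jump F K u t) (cconj2 (jump F K v t))
      + beta / (iC * k) * gjump F K u t * conjc (gjump F K v t)
  | inr Dirichlet =>
      - ntrace F u t * conjc (trace F v t)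
      - alpha * iC * k * trace F u t * conjc (trace F v t)
  | inr Impedance =>
      (1 - delta) * trace F u t * conjc (ntrace F v t)
      - delta * ntrace F u t * conjc (trace F v t)
      - iC * (1 - delta) * k * trace F u t * conjc (trace F v t)
      + delta / (iC * k) * ntrace F u t * conjc (ntrace F v t)
  | inr Truncated =>
      trace F u t * conjc (ntrace F v t)
      - D u * conjc (trace F v t)
      + delta / (iC * k) * (ntrace F u t - D u) * conjc (ntrace F v t - D v)
  end.

Definition A_h (u v : cauchy_data) : R[i] :=
  \sum_(F : face M) carc_int (curve F) (A_integrand u v F).

(* The integrand on the truncation circle is the one that makes the method
   consistent for the condition du/dn - DtN_N u = gR. *)
Definition load_integrand (gD gA gR : R * R -> R[i]) (v : cauchy_data) F (t : R)
    : R[i] :=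
  let x := curve F t in
  match nbr F with
  | inl _ => 0
  | inr Dirichlet =>
      - (gD x * (conjc (ntrace F v t) + alpha * iC * k * conjc (trace F v t)))
  | inr Impedance =>
      (1 - delta) * gA x * conjc (trace F v t)
      + delta / (iC * k) * gA x * conjc (ntrace F v t)
  | inr Truncated =>
      gR x * conjc (trace F v t)
      + delta / (iC * k) * gR x * conjc (ntrace F v t - dtn kappa (fl_N p) v x)
  end.

Definition load (gD gA gR : R * R -> R[i]) (v : cauchy_data) : R[i] :=
  \sum_(F : face M) carc_int (curve F) (load_integrand gD gA gR v F).

Definition boundary_data (u : broken) (gD gA gR : R * R -> R[i]) : Prop :=
  forall F t, 0 < t < 1 ->
  let x := curve F t in
  match nbr F with
  | inl _ => True
  | inr Dirichlet => trace F (jet u) t = gD x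
  | inr Impedance =>
      ntrace F (jet u) t - iC * k * trace F (jet u) t = gA x
  | inr Truncated =>
      ntrace F (jet u) t - dtn kappa (fl_N p) (jet u) x = gR x
  end.

Definition pwdg_solution (V : set broken) (gD gA gR : R * R -> R[i])
    (uh : broken) : Prop :=
  V uh /\ forall v, V v -> A_h (jet uh) (jet v) = load gD gA gR (jet v).

Definition DG_sq (w : cauchy_data) : R := - complex.Im (A_h w w).

Definition DGplus_sq (Q : cauchy_data -> R) (w : cauchy_data) : R :=
  DG_sq w
  + \sum_(F : face M) arc_int (curve F) (fun t =>
      match nbr F with
      | inl K => kappa^-1 * vabs2 (gavg F K w t) + kappa * abs2 (avg F K w t)
      | inr Dirichlet => kappa^-1 * abs2 (ntrace F w t)
      | inr _ => 0
      end)
  + (if [exists F : face M, truncated F] then Q w else 0).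

Definition DG_norm (v : broken) : R := Num.sqrt (DG_sq (jet v)).
Definition DGplus_norm (Q : cauchy_data -> R) (v : broken) : R :=
  Num.sqrt (DGplus_sq Q (jet v)).

Definition face_constant (Q : cauchy_data -> R) (C : R) : Prop :=
  0 <= C /\ forall (v : broken) (w : cauchy_data),
    trefftz kappa v -> cauchy_trace v w ->
    DGplus_sq Q w <= C * \sum_K bd_sq kappa K w.

End Forms.

Definition ccomb (a : R[i]) (w w' : cauchy_data) : cauchy_data := fun K x =>
  (a * (w K x).1 + (w' K x).1,
   (a * (w K x).2.1 + (w' K x).2.1, a * (w K x).2.2 + (w' K x).2.2)).

Definition truncation_form (Q : cauchy_data -> R) : Prop :=
  [/\ exists2 b : cauchy_data -> cauchy_data -> R[i],
        (forall a w w' w'', L2_cauchy w -> L2_cauchy w' -> L2_cauchy w'' ->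
           b (ccomb a w w') w'' = a * b w w'' + b w' w'') &
        (forall w w', L2_cauchy w -> L2_cauchy w' -> b w' w = conjc (b w w'))
        /\ (forall w, L2_cauchy w -> (Q w)%:C = b w w),
      forall w, L2_cauchy w -> 0 <= Q w &
      forall w w', L2_cauchy w -> L2_cauchy w' ->
        (forall F, truncated F -> forall t, 0 <= t <= 1 ->
           w (plus F) (curve F t) = w' (plus F) (curve F t)) -> Q w = Q w'].

Definition trefftz_space (kappa : R) (xK : elt M -> R * R) (V : set broken)
    : Prop :=
  [/\ exists (n : nat) (b : 'I_n -> broken),
        V = [set v | exists a : 'I_n -> R[i],
               v = fun K x => \sum_(i < n) a i * b i K x],
      V `<=` trefftz kappa &
      forall v, V v -> forall K, local_combination kappa (xK K) (v K)].

End PWDG.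

Section Constants.
Context {R : realType} (M : mesh R).
Variables (kappa eta h : R) (K : elt M).

Definition D_eta : R := Num.sqrt (cosh (2 * eta)).
Definition E_K : R := expR (kappa * h * sinh eta).
Definition P_K : R := (1 + kappa * h * D_eta) ^+ 2.
Definition C_H1 : R :=
  Num.sqrt (area K) * kappa * D_eta * E_K * Num.sqrt (h ^+ 2 + P_K).
Definition C_tr : R :=
  Num.sqrt (2 * pi * h * kappa * D_eta ^+ 2 * E_K ^+ 2
            * ((kappa * h) ^+ 2 + P_K)).
Definition C_bd : R :=
  Num.sqrt (perimeter K * kappa * D_eta ^+ 2 * E_K ^+ 2
            * ((kappa * h) ^+ 2 + P_K)).

End Constants.

(* Main.v *)
Require Import Defs.
From mathcomp Require Import all_boot all_order all_algebra complex.
From mathcomp Require Import all_classical all_reals all_analysis.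
From mathcomp Require Import measurable_realfun ring lra.

Set Implicit Arguments.
Unset Strict Implicit.
Unset Printing Implicit Defensive.

Import Order.TTheory GRing.Theory Num.Theory.
Import numFieldNormedType.Exports.
Local Open Scope classical_set_scope.
Local Open Scope ring_scope.

(** A competitor in the recovered space is obtained by keeping the exact
    coefficients and moving only the angles: on [K] it is
    [\sum_j c_j psi_(zhat_j)]. All three infima are bounded by its error
    [\sum_j c_j (psi_(z_j) - psi_(zhat_j))], so everything rests on how much a
    plane wave moves with its angle.

    Join [z] to [zhat] by a segment, which stays in the strip
    [|Im z| <= eta] by convexity. The directions [d(z)] and [d'(z)] both have
    squared length [cosh (2 Im z)], hence length at most [D_eta]; on the disc of
    radius [h] the wave itself has modulus at most [E_K], because its exponent
    has real part [- kappa Im (d(z) . r)] and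
    [|Im (d(z) . r)| <= |sinh (Im z)| |r|]. As the derivative of
    [exp (i kappa d(z) . r)] in [z] is [i kappa (d'(z) . r)] times the wave,
    the mean value inequality gives
    [|psi_zhat - psi_z| <= kappa D h E |zhat - z|], and similarly
    [kappa D E (1 + kappa h D) |zhat - z|] for a component of the gradient
    ([planewave_perturbation], [planewave_grad_perturbation]). The
    Cauchy-Schwarz inequality over [j] turns these into pointwise bounds of the
    error by [||c_K|| delta_K] ([abs2_error_le], [vabs2_grad_error_le]).

    Each norm is an integral of the squared error and gradient over a set
    contained in the closed disc of radius [h] (the element, the circle, the
    boundary of the element), so multiplying the pointwise bounds by the measure
    of that set gives exactly the three constants ([H1_error_le],
    [tr_error_le], [bd_error_le]).

    For the last claim the face inequality is applied to the error. It is
    stated for Trefftz functions with a nontangential Cauchy trace: a finite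
    sum of plane waves is smooth, solves the Helmholtz equation on the whole
    plane, and has its own jet as trace, with a constant as maximal function
    ([broken_error_trefftz], [broken_error_cauchy_trace]). *)

(** * Complex modulus and Cauchy-Schwarz inequalities *)

Section Modulus.
Context {R : realType}.
Implicit Types (a b w z : R[i]) (u v : R[i] * R[i]).

Lemma cabsE z : cabs z = ComplexField.Normc.normc z.
Proof. by case: z. Qed.

Lemma abs2_ge0 z : 0 <= abs2 z.
Proof. by rewrite addr_ge0 ?sqr_ge0. Qed.

Lemma vabs2_ge0 v : 0 <= vabs2 v.
Proof. by rewrite addr_ge0 ?abs2_ge0. Qed.

Lemma cabs_ge0 z : 0 <= cabs z.
Proof. exact: sqrtr_ge0. Qed.

Lemma sqr_cabs z : cabs z ^+ 2 = abs2 z.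
Proof. by rewrite sqr_sqrtr ?abs2_ge0. Qed.

Lemma cabsM a b : cabs (a * b) = cabs a * cabs b.
Proof. by rewrite !cabsE ComplexField.Normc.normcM. Qed.

Lemma cabsD a b : cabs (a + b) <= cabs a + cabs b.
Proof. by rewrite !cabsE; exact: le_normcD. Qed.

Lemma cabsN a : cabs (- a) = cabs a.
Proof. by rewrite !cabsE normcN. Qed.

Lemma cabs0 : cabs (0 : R[i]) = 0.
Proof. by rewrite cabsE ComplexField.Normc.normc0. Qed.

Lemma cabs_real (x : R) : cabs x%:C%C = `|x|.
Proof. by rewrite /cabs /abs2 /= expr0n addr0 sqrtr_sqr. Qed.

Lemma cabs_iC : cabs (iC : R[i]) = 1.
Proof. by rewrite /cabs /abs2 /= expr0n add0r expr1n sqrtr1. Qed.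

Lemma sum_cabs (I : Type) (s : seq I) (f : I -> R[i]) :
  cabs (\sum_(i <- s) f i) <= \sum_(i <- s) cabs (f i).
Proof.
elim/big_ind2: _ => // [|x x' y y' h h']; first by rewrite cabs0.
by rewrite (le_trans (cabsD _ _))// lerD.
Qed.

Lemma cReMconj z : complex.Re (conjc z * z) = abs2 z.
Proof. by case: z => x y /=; rewrite /abs2 /=; ring. Qed.

Lemma Re_le_cabs z : complex.Re z <= cabs z.
Proof.
apply: (le_trans (ler_norm _)).
by rewrite -sqrtr_sqr ler_wsqrtr// lerDl sqr_ge0.
Qed.

Lemma cabs_conj z : cabs (conjc z) = cabs z.
Proof. by case: z => x y; rewrite /cabs /abs2 /= sqrrN. Qed.

Lemma cdot_conj v : cdot v (cconj2 v) = (vabs2 v)%:C%C.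
Proof.
case: v => [[x y] [x' y']]; apply/eqP; rewrite eq_complex /=.
by rewrite /vabs2 /abs2 /=; apply/andP; split; apply/eqP; ring.
Qed.

Lemma vabs2_conj v : vabs2 (cconj2 v) = vabs2 v.
Proof. by case: v => [[x y] [x' y']]; rewrite /vabs2 /abs2 /= !sqrrN. Qed.

Lemma cdot_cauchy_schwarz u v :
  cabs (cdot u v) <= Num.sqrt (vabs2 u) * Num.sqrt (vabs2 v).
Proof.
rewrite -sqrtrM ?vabs2_ge0// ler_wsqrtr//.
case: u v => [[a b] [c d]] [[a' b'] [c' d']].
rewrite /cdot /vabs2 /abs2 /= -subr_ge0.
(* Lagrange's identity for a bilinear product: the defect is the squared
   modulus of a1 conj(b2) - a2 conj(b1). *)
have -> : (a ^+ 2 + b ^+ 2 + (c ^+ 2 + d ^+ 2))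
  * (a' ^+ 2 + b' ^+ 2 + (c' ^+ 2 + d' ^+ 2))
  - ((a * a' - b * b' + (c * c' - d * d')) ^+ 2
     + (a * b' + b * a' + (c * d' + d * c')) ^+ 2)
  = (a * c' + b * d' - (c * a' + d * b')) ^+ 2
    + (b * c' - a * d' - (d * a' - c * b')) ^+ 2 by ring.
by rewrite addr_ge0 ?sqr_ge0.
Qed.

(** The defect is half the double sum of the squares
    [(f i * g j - f j * g i) ^+ 2]. *)
Lemma sum_cauchy_schwarz n (f g : 'I_n -> R) :
  (\sum_i f i * g i) ^+ 2 <= (\sum_i f i ^+ 2) * (\sum_i g i ^+ 2).
Proof.
have H : \sum_i \sum_j (f i * g j - f j * g i) ^+ 2 =
   2 * ((\sum_i f i ^+ 2) * (\sum_i g i ^+ 2) - (\sum_i f i * g i) ^+ 2).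
  rewrite expr2 !big_distrlr /= -sumrB mulr_sumr.
  transitivity (\sum_i \sum_j (f i ^+ 2 * g j ^+ 2 - f i * g i * (f j * g j))
     + \sum_i \sum_j (f j ^+ 2 * g i ^+ 2 - f i * g i * (f j * g j))).
    rewrite -big_split; apply: eq_bigr => i _.
    by rewrite -big_split; apply: eq_bigr => j _ /=; ring.
  rewrite [X in _ + X]exchange_big /= -big_split /=; apply: eq_bigr => i _.
  rewrite -sumrB mulr_sumr -big_split /=.
  by apply: eq_bigr => j _; ring.
have : 0 <= \sum_i \sum_j (f i * g j - f j * g i) ^+ 2.
  by apply: sumr_ge0 => i _; apply: sumr_ge0 => j _; exact: sqr_ge0.
by rewrite H pmulr_rge0// subr_ge0.
Qed.

Lemma l2_sq_ge0 n (a : 'I_n -> R[i]) : 0 <= l2_sq a.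
Proof. by apply: sumr_ge0 => j _; exact: abs2_ge0. Qed.

(** How a perturbation bound for the single waves passes to their linear
    combinations: the triangle inequality, then Cauchy-Schwarz. *)
Lemma abs2_comb_le n (B : R) (c d f : 'I_n -> R[i]) :
  (forall j, cabs (f j) <= B * cabs (d j)) ->
  abs2 (\sum_j c j * f j) <= B ^+ 2 * (l2_sq c * l2_sq d).
Proof.
move=> fB; rewrite -sqr_cabs.
have H : cabs (\sum_j c j * f j) <= B * \sum_j cabs (c j) * cabs (d j).
  rewrite (le_trans (sum_cabs _ _))// mulr_sumr ler_sum// => j _.
  by rewrite cabsM mulrCA ler_wpM2l ?cabs_ge0.
rewrite (le_trans (lerXn2r 2 _ _ H)) ?nnegrE ?cabs_ge0//.
  exact: le_trans (cabs_ge0 _) H.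
rewrite exprMn ler_wpM2l ?sqr_ge0// (le_trans (sum_cauchy_schwarz _ _))//.
by under eq_bigr do rewrite sqr_cabs; under [X in _ * X]eq_bigr do rewrite sqr_cabs.
Qed.

End Modulus.

(** * Complex-valued functions of a real variable *)

Section RealPaths.
Context {R : realType}.
Implicit Types (f g : R -> R[i]) (t : R) (z w : R[i]).

Lemma cReD z w : complex.Re (z + w) = complex.Re z + complex.Re w.
Proof. by case: z w => [? ?] [? ?]. Qed.

Lemma cReB z w : complex.Re (z - w) = complex.Re z - complex.Re w.
Proof. by case: z w => [? ?] [? ?]. Qed.

Lemma cImD z w : complex.Im (z + w) = complex.Im z + complex.Im w.
Proof. by case: z w => [? ?] [? ?]. Qed.

Lemma cReM z w : complex.Re (z * w) =
  complex.Re z * complex.Re w - complex.Im z * complex.Im w.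
Proof. by case: z w => [? ?] [? ?]. Qed.

Lemma cImM z w : complex.Im (z * w) =
  complex.Re z * complex.Im w + complex.Im z * complex.Re w.
Proof. by case: z w => [? ?] [? ?]. Qed.

(** Derivative of a path in the complex plane. Only real derivatives of paths are
    needed: angles move along segments and points along coordinate lines. *)
Definition cderiv f t (df : R[i]) : Prop :=
  is_derive t 1 (fun s => complex.Re (f s)) (complex.Re df) /\
  is_derive t 1 (fun s => complex.Im (f s)) (complex.Im df).

Lemma cderiv_eq f t df df' : cderiv f t df -> df = df' -> cderiv f t df'.
Proof. by move=> + <-. Qed.

Lemma cderiv_cst w t : cderiv (fun=> w) t 0.
Proof. by split; exact: is_derive_cst. Qed.

Lemma cderivD f g t df dg :
  cderiv f t df -> cderiv g t dg -> cderiv (fun s => f s + g s) t (df + dg).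
Proof.
move=> [f1 f2] [g1 g2]; split.
  by under eq_fun do rewrite cReD; rewrite cReD; exact: is_deriveD.
by under eq_fun do rewrite cImD; rewrite cImD; exact: is_deriveD.
Qed.

Lemma cderivM f g t df dg :
  cderiv f t df -> cderiv g t dg ->
  cderiv (fun s => f s * g s) t (df * g t + f t * dg).
Proof.
move=> [f1 f2] [g1 g2]; split.
  under eq_fun do rewrite cReM.
  apply: is_derive_eq.
  by rewrite cReD !cReM /GRing.scale /=; ring.
under eq_fun do rewrite cImM.
apply: is_derive_eq.
by rewrite cImD !cImM /GRing.scale /=; ring.
Qed.

Lemma cderivZ w f t df : cderiv f t df -> cderiv (fun s => w * f s) t (w * df).
Proof.
move=> fd; apply: cderiv_eq; first exact: (cderivM (cderiv_cst w t) fd).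
by rewrite mul0r add0r.
Qed.

Lemma cderivN f t df : cderiv f t df -> cderiv (fun s => - f s) t (- df).
Proof.
by move=> /(cderivZ (-1)); rewrite mulN1r; under eq_fun do rewrite mulN1r.
Qed.

Lemma cderiv_real t : cderiv (fun s => s%:C%C) t 1.
Proof. by split; [exact: is_derive_id|exact: is_derive_cst]. Qed.

Lemma cderiv_exp f t df :
  cderiv f t df -> cderiv (fun s => cexp (f s)) t (df * cexp (f t)).
Proof.
move=> [f1 f2].
have e1 : is_derive t 1 (fun s => expR (complex.Re (f s)))
    (complex.Re df * expR (complex.Re (f t))).
  apply: is_derive_eq.
  by rewrite mulrC.
have e2 : is_derive t 1 (fun s => cos (complex.Im (f s)))
    (complex.Im df * - sin (complex.Im (f t))).
  apply: is_derive_eq.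
  by rewrite mulrC.
have e3 : is_derive t 1 (fun s => sin (complex.Im (f s)))
    (complex.Im df * cos (complex.Im (f t))).
  apply: is_derive_eq.
  by rewrite mulrC.
split.
  apply: is_derive_eq.
  by rewrite cReM /GRing.scale /=; ring.
apply: is_derive_eq.
by rewrite cImM /GRing.scale /=; ring.
Qed.

(** The mean value theorem fails for complex-valued paths, but it applies to the
    real function [Re (conj w * f)] with [w := f 1 - f 0], whose increment is
    [|w|^2] and whose derivative is at most [|w| B]. *)
Lemma cderiv_increment_le f df B :
  (forall t, cderiv f t (df t)) ->
  (forall t, 0 <= t <= 1 -> cabs (df t) <= B) ->
  cabs (f 1 - f 0) <= B.
Proof.
move=> fd dB; set w := f 1 - f 0.
have gd t : cderiv (fun s => conjc w * f s) t (conjc w * df t).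
  exact: cderivZ.
have gc : {within `[0, 1], continuous (fun s => complex.Re (conjc w * f s) : R)}.
  apply: derivable_within_continuous => t _.
  by have [[]] := gd t.
have [c c01] := MVT_segment ler01 (fun t _ => (gd t).1) gc.
rewrite -cReB -mulrBr cReMconj subr0 mulr1 -sqr_cabs => e.
have [/eqP->|w0] := boolP (cabs w == 0).
  apply: (le_trans (cabs_ge0 (df 0))); apply: dB; lra.
rewrite -(ler_pM2l (_ : 0 < cabs w)) ?lt_def ?w0 ?cabs_ge0//.
rewrite -expr2 e (le_trans (Re_le_cabs _))// cabsM cabs_conj.
by rewrite ler_wpM2l ?cabs_ge0// dB.
Qed.

End RealPaths.

(** * Complex trigonometry of the directions *)

Section ComplexTrigonometry.
Context {R : realType}.
Implicit Types (a b x y eta : R) (z w : R[i]) (f : R -> R[i]).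

Lemma cexpD z w : cexp (z + w) = cexp z * cexp w.
Proof.
case: z w => [a b] [c d]; apply/eqP; rewrite eq_complex /= expRD sinD cosD.
by apply/andP; split; apply/eqP; ring.
Qed.

Lemma cexp0 : cexp (0 : R[i]) = 1.
Proof. by apply/eqP; rewrite eq_complex /= expR0 cos0 sin0 mulr0 mulr1 !eqxx. Qed.

Lemma cabs_cexp z : cabs (cexp z) = expR (complex.Re z).
Proof.
rewrite /cabs /abs2 /= !exprMn -mulrDr cos2Dsin2 mulr1 sqrtr_sqr.
by rewrite ger0_norm ?expR_ge0.
Qed.

Lemma iC2 : iC * iC = -1 :> R[i].
Proof. by rewrite -expr2 /iC sqr_i. Qed.

Lemma iC_neq0 : iC != 0 :> R[i].
Proof. by rewrite eq_complex /= oner_eq0 andbF. Qed.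

Lemma ccosE a b : ccos (a +i* b)%C =
  ((cos a * cosh b) +i* (- (sin a * sinh b)))%C.
Proof.
apply: (@mulfI _ (2 : R[i])); first by rewrite pnatr_eq0.
rewrite /ccos /cosh /sinh mulrC divfK ?pnatr_eq0//.
rewrite /cexp /iC; apply/eqP; rewrite eq_complex /=.
rewrite ?(mul0r, mul1r, add0r, sub0r, addr0, opprK, cosN, sinN, subr0).
by apply/andP; split; apply/eqP; field.
Qed.

Lemma csinE a b : csin (a +i* b)%C =
  ((sin a * cosh b) +i* (cos a * sinh b))%C.
Proof.
apply: (@mulfI _ (2 * iC : R[i])); first by rewrite mulf_neq0 ?pnatr_eq0 ?iC_neq0.
rewrite /csin /cosh /sinh mulrC divfK ?mulf_neq0 ?pnatr_eq0 ?iC_neq0//.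
rewrite /cexp /iC; apply/eqP; rewrite eq_complex /=.
rewrite ?(mul0r, mul1r, add0r, sub0r, addr0, opprK, cosN, sinN, subr0).
by apply/andP; split; apply/eqP; field.
Qed.

Lemma ccos2Dcsin2 z : ccos z ^+ 2 + csin z ^+ 2 = 1.
Proof.
have e : cexp (iC * z) * cexp (- (iC * z)) = 1 by rewrite -cexpD subrr cexp0.
have i2 := iC2; have i0 := iC_neq0.
rewrite /ccos /csin !expr_div_n exprMn [iC ^+ 2]expr2 i2.
transitivity (cexp (iC * z) * cexp (- (iC * z))); last exact: e.
by field.
Qed.

Lemma cderiv_cos f t df :
  cderiv f t df -> cderiv (fun s => ccos (f s)) t (df * - csin (f t)).
Proof.
move=> fd; have d1 := cderiv_exp (cderivZ iC fd).
have d2 := cderiv_exp (cderivN (cderivZ iC fd)).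
have := cderivZ 2^-1 (cderivD d1 d2); rewrite /ccos.
under eq_fun do rewrite mulrC; move/cderiv_eq; apply.
have i2 : iC * iC = -1 :> R[i] := iC2; have i0 := iC_neq0.
have -> : df * - csin (f t) = df * (iC * iC) * csin (f t) by rewrite i2; ring.
by rewrite /csin; field.
Qed.

Lemma cderiv_sin f t df :
  cderiv f t df -> cderiv (fun s => csin (f s)) t (df * ccos (f t)).
Proof.
move=> fd; have d1 := cderiv_exp (cderivZ iC fd).
have d2 := cderiv_exp (cderivN (cderivZ iC fd)).
have := cderivZ (2 * iC)^-1 (cderivD d1 (cderivN d2)); rewrite /csin.
under eq_fun do rewrite mulrC; move/cderiv_eq; apply.
have i0 := iC_neq0.
by rewrite /ccos; field.
Qed.

Lemma sinh_le x y : x <= y -> sinh x <= sinh y.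
Proof.
by move=> xy; rewrite ler_pM2r ?invr_gt0// lerB// ler_expR ?lerN2.
Qed.

Lemma sinhN x : sinh (- x) = - sinh x.
Proof. by rewrite /sinh opprK -mulNr opprB. Qed.

Lemma norm_sinh_le x eta : `|x| <= eta -> `|sinh x| <= sinh eta.
Proof.
by rewrite !ler_norml -sinhN => /andP[? ?]; rewrite !sinh_le.
Qed.

Lemma cosh2Dsinh2 x : cosh x ^+ 2 + sinh x ^+ 2 = cosh (2 * x).
Proof.
rewrite /cosh /sinh !expr_div_n mulr2n !mulrDl !mul1r opprD !expRD.
by field.
Qed.

Lemma cosh2E x : cosh (2 * x) = 1 + 2 * sinh x ^+ 2.
Proof.
have e : expR x * expR (- x) = 1 by rewrite -expRD subrr expR0.
rewrite -cosh2Dsinh2; suff -> : cosh x ^+ 2 = 1 + sinh x ^+ 2 by ring.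
transitivity (expR x * expR (- x) + sinh x ^+ 2); last by rewrite e.
by rewrite /cosh /sinh; field.
Qed.

Lemma cosh2_le x eta : `|x| <= eta -> cosh (2 * x) <= cosh (2 * eta).
Proof.
move=> xe; rewrite !cosh2E lerD2l ler_pM2l// -real_normK ?num_real//.
rewrite lerXn2r ?nnegrE ?norm_sinh_le//.
by rewrite (le_trans (normr_ge0 _) (norm_sinh_le xe)).
Qed.

Definition cdir z : R[i] * R[i] := (ccos z, csin z).
Definition dcdir z : R[i] * R[i] := (- csin z, ccos z).

Lemma vabs2_cdir z : vabs2 (cdir z) = cosh (2 * complex.Im z).
Proof.
case: z => a b; rewrite /vabs2 /cdir /= ccosE csinE /abs2 /= -cosh2Dsinh2.
rewrite sqrrN !exprMn addrACA -!mulrDl [sin a ^+ 2 + _]addrC.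
by rewrite !(cos2Dsin2, mul1r) mulrDl.
Qed.

Lemma vabs2_dcdir z : vabs2 (dcdir z) = cosh (2 * complex.Im z).
Proof.
rewrite -vabs2_cdir /vabs2 /cdir /dcdir /= addrC; congr (_ + _).
by case: (csin z) => a b; rewrite /abs2 /= !sqrrN.
Qed.

Lemma vabs2_cvec (r : R * R) : Num.sqrt (vabs2 (cvec r)) = enorm r.
Proof. by rewrite /vabs2 /cvec /abs2 /enorm /= expr0n !addr0. Qed.

(** The imaginary part of the complex direction of angle [a + i b] is [sinh b]
    times the real unit vector [(- sin a, cos a)]; this controls the growth of an
    evanescent wave. *)
Lemma Im_cdot_cdir z (r : R * R) :
  `|complex.Im (cdot (cdir z) (cvec r))| <= `|sinh (complex.Im z)| * enorm r.
Proof.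
case: z r => a b [x y]; rewrite /cdir ccosE csinE /= !mulr0 !add0r.
rewrite -[X in `|X|]/(- (sin a * sinh b) * x + cos a * sinh b * y).
have -> : - (sin a * sinh b) * x + cos a * sinh b * y =
  sinh b * (cos a * y - sin a * x) by ring.
rewrite normrM ler_wpM2l// -sqrtr_sqr ler_wsqrtr//= -subr_ge0.
have -> : x ^+ 2 + y ^+ 2 - (cos a * y - sin a * x) ^+ 2 =
  (cos a * x + sin a * y) ^+ 2 + (1 - (cos a ^+ 2 + sin a ^+ 2)) * (x ^+ 2 + y ^+ 2).
  by ring.
by rewrite cos2Dsin2 subrr mul0r addr0 sqr_ge0.
Qed.

End ComplexTrigonometry.

(** * Sensitivity of a plane wave to its angle *)

Section PlaneWaveBounds.
Context {R : realType}.
Variables (kappa eta h : R) (x0 : R * R).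
Hypothesis kappa_gt0 : 0 < kappa.
Implicit Types (z : R[i]) (x : R * R).

Let k : R[i] := kappa%:C%C.
Let D := D_eta eta.
Let E := E_K kappa eta h.

Lemma cabs_planewave_le z x : `|complex.Im z| <= eta -> enorm (x - x0) <= h ->
  cabs (planewave kappa x0 z x) <= E.
Proof.
move=> ze xh; rewrite /planewave cabs_cexp ler_expR -[(ccos z, csin z)]/(cdir z).
have -> w : complex.Re (iC * kappa%:C%C * w) = kappa * - complex.Im w.
  by case: w => a b /=; ring.
rewrite -mulrA ler_pM2l// (le_trans (ler_norm _))// normrN.
rewrite (le_trans (Im_cdot_cdir _ _))// mulrC ler_pM ?sqrtr_ge0//.
exact: norm_sinh_le.
Qed.

Lemma sqrt_vabs2_cdir_le z : `|complex.Im z| <= eta ->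
  Num.sqrt (vabs2 (cdir z)) <= D.
Proof. by move=> ze; rewrite vabs2_cdir ler_wsqrtr ?cosh2_le. Qed.

Lemma sqrt_vabs2_dcdir_le z : `|complex.Im z| <= eta ->
  Num.sqrt (vabs2 (dcdir z)) <= D.
Proof. by move=> ze; rewrite vabs2_dcdir ler_wsqrtr ?cosh2_le. Qed.

Lemma cabs_cdot_le (u v : R[i] * R[i]) B : Num.sqrt (vabs2 u) <= B ->
  cabs (cdot u v) <= B * Num.sqrt (vabs2 v).
Proof.
move=> uB; rewrite (le_trans (cdot_cauchy_schwarz _ _))//.
by rewrite ler_wpM2r ?sqrtr_ge0.
Qed.

Definition segment z zhat (t : R) : R[i] := z + t%:C%C * (zhat - z).

Lemma Im_segment z zhat t : 0 <= t <= 1 ->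
  `|complex.Im z| <= eta -> `|complex.Im zhat| <= eta ->
  `|complex.Im (segment z zhat t)| <= eta.
Proof.
case: z zhat => [a b] [a' b'] t01; rewrite /segment /= mul0r addr0 !ler_norml.
by move=> /andP[? ?] /andP[? ?]; apply/andP; split; nra.
Qed.

Lemma cderiv_segment z zhat t : cderiv (segment z zhat) t (zhat - z).
Proof.
have := cderivD (cderiv_cst z t) (cderivM (cderiv_real t) (cderiv_cst (zhat - z) t)).
by move/cderiv_eq; apply; rewrite mulr0 addr0 add0r mul1r.
Qed.

Lemma cderiv_cdir f t df (w : R[i] * R[i]) : cderiv f t df ->
  cderiv (fun s => cdot (cdir (f s)) w) t (df * cdot (dcdir (f t)) w).
Proof.
move=> fd; have := cderivD (cderivM (cderiv_cos fd) (cderiv_cst w.1 t))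
                           (cderivM (cderiv_sin fd) (cderiv_cst w.2 t)).
by move/cderiv_eq; apply; rewrite !mulr0 !addr0 /cdot /dcdir /=; ring.
Qed.

Lemma cderiv_planewave_angle f t df x : cderiv f t df ->
  cderiv (fun s => planewave kappa x0 (f s) x) t
    (df * (iC * k * cdot (dcdir (f t)) (cvec (x - x0)))
        * planewave kappa x0 (f t) x).
Proof.
move=> fd; have := cderiv_exp (cderivZ (iC * k) (cderiv_cdir (cvec (x - x0)) fd)).
by move/cderiv_eq; apply; rewrite mulrCA.
Qed.

Section Perturbation.
Variables (z zhat : R[i]) (x : R * R).
Hypotheses (ze : `|complex.Im z| <= eta) (zhate : `|complex.Im zhat| <= eta).
Hypothesis xh : enorm (x - x0) <= h.

Let D_ge0 : 0 <= D. Proof. exact: sqrtr_ge0. Qed.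
Let seg1 : segment z zhat 1 = zhat.
Proof. by rewrite /segment mul1r addrC subrK. Qed.
Let seg0 : segment z zhat 0 = z.
Proof. by rewrite /segment mul0r addr0. Qed.

Lemma cabs_angle_factor t : 0 <= t <= 1 ->
  cabs (iC * k * cdot (dcdir (segment z zhat t)) (cvec (x - x0)))
    <= kappa * (D * h).
Proof.
move=> t01; rewrite !cabsM cabs_iC cabs_real gtr0_norm// mul1r ler_pM2l//.
rewrite (le_trans (cabs_cdot_le _ (sqrt_vabs2_dcdir_le (Im_segment t01 ze zhate))))//.
by rewrite vabs2_cvec ler_wpM2l.
Qed.

Lemma planewave_perturbation :
  cabs (planewave kappa x0 zhat x - planewave kappa x0 z x)
    <= kappa * D * E * h * cabs (zhat - z).
Proof.
pose f t := planewave kappa x0 (segment z zhat t) x.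
have <- : f 1 - f 0 = planewave kappa x0 zhat x - planewave kappa x0 z x.
  by rewrite /f seg1 seg0.
apply: cderiv_increment_le => t.
  exact: cderiv_planewave_angle (cderiv_segment z zhat t).
move=> t01; have st := Im_segment t01 ze zhate.
rewrite 2!cabsM -mulrA mulrC.
rewrite ler_wpM2r ?cabs_ge0//.
apply: le_trans (ler_pM (cabs_ge0 _) (cabs_ge0 _) (cabs_angle_factor t01)
  (cabs_planewave_le st xh)) _.
by rewrite le_eqVlt; apply/orP; left; apply/eqP; ring.
Qed.

(** The gradient is [iC * kappa * psi *: d(z)]. Testing it against a vector [w]
    makes the quantity scalar, so that the mean value inequality for paths in
    the complex plane applies; the norm of the gradient is recovered later by a
    choice of [w]. The two terms in [1 + kappa * h * D] come from differentiating
    the direction and the exponential. *)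
Lemma planewave_grad_perturbation (w : R[i] * R[i]) :
  cabs (cdot (cdir zhat) w * planewave kappa x0 zhat x
        - cdot (cdir z) w * planewave kappa x0 z x)
    <= D * E * (1 + kappa * h * D) * Num.sqrt (vabs2 w) * cabs (zhat - z).
Proof.
pose f t := cdot (cdir (segment z zhat t)) w * planewave kappa x0 (segment z zhat t) x.
have <- : f 1 - f 0 = cdot (cdir zhat) w * planewave kappa x0 zhat x
        - cdot (cdir z) w * planewave kappa x0 z x.
  by rewrite /f seg1 seg0.
apply: cderiv_increment_le => t.
  have sd := cderiv_segment z zhat t.
  exact: cderivM (cderiv_cdir w sd) (cderiv_planewave_angle x sd).
move=> t01; have st := Im_segment t01 ze zhate.
have H1 := cabs_planewave_le st xh.
have H2 := cabs_cdot_le w (sqrt_vabs2_cdir_le st).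
have H3 := cabs_cdot_le w (sqrt_vabs2_dcdir_le st).
have H4 := cabs_angle_factor t01.
set W := Num.sqrt _ in H2 H3 *; have W0 : 0 <= W by exact: sqrtr_ge0.
rewrite (le_trans (cabsD _ _))//.
set p := planewave _ _ _ _ in H1 *; set d := zhat - z.
set A := cdot (dcdir _) w in H3 *; set A' := cdot (cdir _) w in H2 *.
set G := iC * k * _ in H4 *.
clearbody A A' G p d.
have -> : D * E * (1 + kappa * h * D) * W * cabs d =
  cabs d * ((D * W) * E) + (D * W) * (cabs d * (kappa * (D * h)) * E) by ring.
rewrite !cabsM -mulrA; apply: lerD.
  by rewrite ler_wpM2l ?cabs_ge0// ler_pM ?cabs_ge0.
apply: ler_pM; rewrite ?mulr_ge0 ?cabs_ge0//.
apply: ler_pM; rewrite ?mulr_ge0 ?cabs_ge0//.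
by rewrite ler_wpM2l ?cabs_ge0.
Qed.

End Perturbation.
End PlaneWaveBounds.

(** * Continuity and directional derivatives *)

Section ComplexContinuity.
Context {R : realType} {T : topologicalType}.
Implicit Types (f g : T -> R[i]) (x : T).

Definition ccontinuous f : Prop :=
  continuous (fun y => complex.Re (f y) : R) /\
  continuous (fun y => complex.Im (f y) : R).

Lemma ccontinuous_cst (w : R[i]) : ccontinuous (fun=> w).
Proof. by split=> x; exact: cvg_cst. Qed.

Lemma ccontinuousD f g :
  ccontinuous f -> ccontinuous g -> ccontinuous (fun y => f y + g y).
Proof.
move=> [f1 f2] [g1 g2]; split=> x.
  by under eq_fun do rewrite cReD; apply: cvgD; [exact: f1|exact: g1].
by under eq_fun do rewrite cImD; apply: cvgD; [exact: f2|exact: g2].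
Qed.

Lemma ccontinuousM f g :
  ccontinuous f -> ccontinuous g -> ccontinuous (fun y => f y * g y).
Proof.
move=> [f1 f2] [g1 g2]; split=> x.
  under eq_fun do rewrite cReM.
  by apply: cvgB; apply: cvgM; [exact: f1|exact: g1|exact: f2|exact: g2].
under eq_fun do rewrite cImM.
by apply: cvgD; apply: cvgM; [exact: f1|exact: g2|exact: f2|exact: g1].
Qed.

Lemma ccontinuous_real (f : T -> R) :
  continuous f -> ccontinuous (fun y => (f y)%:C%C).
Proof. by move=> fc; split=> //= x; exact: cvg_cst. Qed.

Lemma ccontinuous_exp f : ccontinuous f -> ccontinuous (fun y => cexp (f y)).
Proof.
move=> [f1 f2]; split=> x; apply: cvgM.
- by apply: (@continuous_comp _ _ _ _ expR); [exact: f1|exact: continuous_expR].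
- by apply: (@continuous_comp _ _ _ _ cos); [exact: f2|exact: continuous_cos].
- by apply: (@continuous_comp _ _ _ _ expR); [exact: f1|exact: continuous_expR].
- by apply: (@continuous_comp _ _ _ _ sin); [exact: f2|exact: continuous_sin].
Qed.

Lemma continuous_abs2 f : ccontinuous f -> continuous (fun y => abs2 (f y)).
Proof.
move=> [f1 f2] x; rewrite /abs2; under eq_fun do rewrite 2!expr2.
by apply: cvgD; apply: cvgM; [exact: f1|exact: f1|exact: f2|exact: f2].
Qed.

End ComplexContinuity.

Section DirectionalDerivatives.
Context {R : realType}.
Implicit Types (f : R * R -> R[i]) (x v : R * R).

(** Directional derivatives are derivatives along a line, which transfers the
    one-variable calculus, chain rule included, to the plane. *)
Lemma is_derive_line (f : R * R -> R) x v df :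
  is_derive (0 : R) 1 (fun t : R => f (x + t *: v)) df -> is_derive x v f df.
Proof.
move=> [g1 g2].
have e : (fun h : R => h^-1 *: ((((fun t : R => f (x + t *: v)) \o shift 0)
           (h *: 1) - f (x + 0 *: v)) : R)) =
  (fun h : R => h^-1 *: (((f \o shift x) (h *: v) - f x) : R)).
  apply/funext => h /=; rewrite scale0r !addr0 [x + _]addrC.
  by rewrite -[h *: 1]/(h * 1) mulr1.
by split; [move: g1|move: g2]; rewrite /derivable /derive e.
Qed.

Definition has_pd (b : bool) f f' : Prop := forall x,
  is_derive x (dir b) (fun y => complex.Re (f y)) (complex.Re (f' x)) /\
  is_derive x (dir b) (fun y => complex.Im (f y)) (complex.Im (f' x)).

Lemma pdE b f f' : has_pd b f f' -> pd b f = f'.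
Proof.
move=> fd; apply/funext => x; have [h1 h2] := fd x.
by rewrite /pd !derive_val; case: (f' x).
Qed.

End DirectionalDerivatives.

(** * Finite sums of plane waves *)

Section PlaneWaveSums.
Context {R : realType}.
Variables (kappa : R) (x0 : R * R).
Implicit Types (s : seq (R[i] * R[i])) (p w : R[i] * R[i]) (x : R * R) (b : bool).

Let k : R[i] := kappa%:C%C.

(** A sum of plane waves is encoded by its list of (coefficient, angle) pairs, so
    that the class is closed under partial derivatives ([pw_pd]) and under
    differences by operations on lists. *)
Definition pwsum s x : R[i] := \sum_(p <- s) p.1 * planewave kappa x0 p.2 x.

Definition pw_pd b p : R[i] * R[i] :=
  (p.1 * (iC * k * (if b then csin p.2 else ccos p.2)), p.2).

Lemma pwsum_cat s s' x : pwsum (s ++ s') x = pwsum s x + pwsum s' x.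
Proof. by rewrite /pwsum big_cat. Qed.

Lemma cderiv_pwsum_line b s x :
  cderiv (fun t => pwsum s (x + t *: dir b)) 0 (pwsum [seq pw_pd b p | p <- s] x).
Proof.
rewrite /pwsum big_map; elim: s => [|[a z] s IH].
  by rewrite big_nil; under eq_fun do rewrite big_nil; exact: cderiv_cst.
rewrite big_cons; under eq_fun do rewrite big_cons.
apply: cderivD => {IH} //=.
have ph t : cdot (cdir z) (cvec (x + t *: dir b - x0)) =
    cdot (cdir z) (cvec (x - x0)) + (if b then csin z else ccos z) * t%:C%C.
  rewrite /cdot /cvec /dir /=; case: b => /=;
  rewrite -[t *: 1]/(t * 1) -[t *: 0]/(t * 0) mulr1 mulr0 !rmorphB !rmorphD/=;
  by rewrite rmorph0; ring.
pose phase t := iC * k * (cdot (cdir z) (cvec (x - x0))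
                          + (if b then csin z else ccos z) * t%:C%C).
have e t : planewave kappa x0 z (x + t *: dir b) = cexp (phase t).
  by rewrite /planewave -[(ccos z, _)]/(cdir z) ph.
under eq_fun do rewrite e.
have e0 : planewave kappa x0 z x = cexp (phase 0).
  by rewrite -e scale0r addr0.
have phd : cderiv phase 0 (iC * k * (if b then csin z else ccos z)).
  have := cderivZ (iC * k) (cderivD (cderiv_cst (cdot (cdir z) (cvec (x - x0))) 0)
    (cderivZ (if b then csin z else ccos z) (cderiv_real 0))).
  by move/cderiv_eq; apply; rewrite add0r mulr1.
have := cderivZ a (cderiv_exp phd); move/cderiv_eq; apply.
by rewrite e0 !mulrA.
Qed.

Lemma pwsum_has_pd b s : has_pd b (pwsum s) (pwsum [seq pw_pd b p | p <- s]).
Proof.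
by move=> x; have [h1 h2] := cderiv_pwsum_line b s x; split; apply: is_derive_line.
Qed.

Lemma pd_pwsum b s : pd b (pwsum s) = pwsum [seq pw_pd b p | p <- s].
Proof. exact: pdE (pwsum_has_pd b s). Qed.

Lemma ccontinuous_pwsum s : ccontinuous (pwsum s).
Proof.
rewrite /pwsum; elim: s => [|[a z] s IH].
  by under eq_fun do rewrite big_nil; exact: ccontinuous_cst.
under eq_fun do rewrite big_cons; apply: ccontinuousD => {IH} //=.
apply: ccontinuousM; first exact: ccontinuous_cst.
apply: ccontinuous_exp; apply: ccontinuousM; first exact: ccontinuous_cst.
rewrite /cdot /cvec /=.
have c1 : continuous (fun y : R * R => (y - x0).1).
  by move=> y; apply: cvgB; [exact: cvg_fst|exact: cvg_cst].
have c2 : continuous (fun y : R * R => (y - x0).2).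
  by move=> y; apply: cvgB; [exact: cvg_snd|exact: cvg_cst].
apply: ccontinuousD; apply: ccontinuousM;
  try exact: ccontinuous_cst; exact: ccontinuous_real.
Qed.

Lemma grad_pwsum s x : grad (pwsum s) x =
  (pwsum [seq pw_pd false p | p <- s] x, pwsum [seq pw_pd true p | p <- s] x).
Proof. by rewrite /grad !pd_pwsum. Qed.

Lemma cdot_grad_pwsum s x w : cdot (grad (pwsum s) x) w =
  \sum_(p <- s) p.1 * (iC * k * (cdot (cdir p.2) w * planewave kappa x0 p.2 x)).
Proof.
rewrite grad_pwsum /cdot /pwsum /= !big_map !mulr_suml -big_split /=.
by apply: eq_bigr => p _; ring.
Qed.

(** The complex direction has bilinear square [cos^2 + sin^2 = 1]. *)
Lemma pwsum_helmholtz s x :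
  laplacian (pwsum s) x + (kappa ^+ 2)%:C%C * pwsum s x = 0.
Proof.
rewrite /laplacian !pd_pwsum /pwsum !big_map mulr_sumr -!big_split big1//=.
move=> [a z] _ /=; rewrite rmorphXn/= -/k.
set C := ccos z; set S := csin z; set p := planewave _ _ _ _.
transitivity (a * p * k ^+ 2 * (iC * iC * (C ^+ 2 + S ^+ 2) + 1)); first ring.
by rewrite iC2 ccos2Dcsin2 mulr1 addNr mulr0.
Qed.

(** A partial derivative of a sum of plane waves is one again, and all of them are
    continuous. *)
Lemma pwsum_C2 (U : set (R * R)) s :
  C2_on U (fun x => complex.Re (pwsum s x)) /\
  C2_on U (fun x => complex.Im (pwsum s x)).
Proof.
have eR a s' : 'D_(dir a) (fun x => complex.Re (pwsum s' x) : R) =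
    (fun x => complex.Re (pwsum [seq pw_pd a p | p <- s'] x)).
  by apply/funext => x; have [[_ ->] _] := pwsum_has_pd a s' x.
have eI a s' : 'D_(dir a) (fun x => complex.Im (pwsum s' x) : R) =
    (fun x => complex.Im (pwsum [seq pw_pd a p | p <- s'] x)).
  by apply/funext => x; have [_ [_ ->]] := pwsum_has_pd a s' x.
split=> x _ a b.
  rewrite !eR; have [[d1 _] _] := pwsum_has_pd a s x.
  have [[d2 _] _] := pwsum_has_pd b [seq pw_pd a p | p <- s] x.
  by split=> //; exact: (ccontinuous_pwsum _).1.
rewrite !eI; have [_ [d1 _]] := pwsum_has_pd a s x.
have [_ [d2 _]] := pwsum_has_pd b [seq pw_pd a p | p <- s] x.
by split=> //; exact: (ccontinuous_pwsum _).2.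
Qed.

Lemma continuous_vabs2_grad_pwsum s : continuous (fun x => vabs2 (grad (pwsum s) x)).
Proof.
under eq_fun do rewrite grad_pwsum /vabs2/=.
by move=> x; apply: cvgD; apply: continuous_abs2; exact: ccontinuous_pwsum.
Qed.

(** * Perturbation of the angles of a plane-wave sum *)

Section Error.
Variables (n : nat) (c z zhat : 'I_n -> R[i]).

Definition angle_error : seq (R[i] * R[i]) :=
  [seq (c j, z j) | j <- index_enum 'I_n] ++
  [seq (- c j, zhat j) | j <- index_enum 'I_n].

Lemma angle_errorE x : pwsum angle_error x =
  \sum_j c j * planewave kappa x0 (z j) x
  - \sum_j c j * planewave kappa x0 (zhat j) x.
Proof.
rewrite pwsum_cat /pwsum !big_map -sumrN; congr (_ + _).
by apply: eq_bigr => j _; rewrite mulNr.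
Qed.

Variables (eta h : R).
Hypothesis kappa_gt0 : 0 < kappa.
Hypotheses (ze : forall j, `|complex.Im (z j)| <= eta)
           (zhate : forall j, `|complex.Im (zhat j)| <= eta).

Let L : R := l2_sq c * l2_sq (fun j => zhat j - z j).
Let D := D_eta eta.
Let E := E_K kappa eta h.
Let P := P_K kappa eta h.

Lemma abs2_error_le x : enorm (x - x0) <= h ->
  abs2 (pwsum angle_error x) <= kappa ^+ 2 * D ^+ 2 * E ^+ 2 * h ^+ 2 * L.
Proof.
move=> xh; rewrite angle_errorE -sumrB.
under eq_bigr do rewrite -mulrBr.
rewrite -3!exprMn; apply: abs2_comb_le => j.
by rewrite -opprB cabsN; exact: planewave_perturbation.
Qed.

(** Testing the gradient [G] against its own conjugate, [G . conj G = |G|^2],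
    bounds [|G|^4] by [|G|^2] times the claimed bound, from the scalar estimate
    above. *)
Lemma vabs2_grad_error_le x : enorm (x - x0) <= h ->
  vabs2 (grad (pwsum angle_error) x) <= kappa ^+ 2 * D ^+ 2 * E ^+ 2 * P * L.
Proof.
move=> xh; set G := grad _ _.
have : abs2 (cdot G (cconj2 G)) <=
    (kappa * (D * E * (1 + kappa * h * D) * Num.sqrt (vabs2 (cconj2 G)))) ^+ 2 * L.
  rewrite /G cdot_grad_pwsum -/G big_cat !big_map /=.
  have -> : \sum_j c j * (iC * k * (cdot (cdir (z j)) (cconj2 G)
                                   * planewave kappa x0 (z j) x))
   + \sum_j - c j * (iC * k * (cdot (cdir (zhat j)) (cconj2 G)
                                   * planewave kappa x0 (zhat j) x)) =
   \sum_j c j * (iC * k * (cdot (cdir (z j)) (cconj2 G)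
                                   * planewave kappa x0 (z j) x
        - cdot (cdir (zhat j)) (cconj2 G) * planewave kappa x0 (zhat j) x)).
    by rewrite -big_split; apply: eq_bigr => j _ /=; ring.
  apply: abs2_comb_le => j; rewrite !cabsM cabs_iC mul1r cabs_real gtr0_norm//.
  rewrite -opprB cabsN -[X in _ <= X]mulrA ler_pM2l//.
  exact: planewave_grad_perturbation.
rewrite vabs2_conj cdot_conj {1}/abs2 /= expr0n addr0.
have [<-|G0] := eqVneq 0 (vabs2 G).
  move=> _; rewrite mulr_ge0 ?(mulr_ge0 (l2_sq_ge0 _) (l2_sq_ge0 _))//.
  by rewrite -!exprMn sqr_ge0.
have G1 : 0 < vabs2 G by rewrite lt_def eq_sym G0 vabs2_ge0.
rewrite !exprMn (sqr_sqrtr (vabs2_ge0 G)) => H.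
rewrite -(ler_pM2l G1) -expr2 (le_trans H)// le_eqVlt; apply/orP; left.
by apply/eqP; rewrite /P /P_K -/D; ring.
Qed.

End Error.
End PlaneWaveSums.

(** * Integrals of bounded continuous functions *)

Section PlaneMeasure.
Context {R : realType}.

Definition box (p : R * R * (R * R)) : set (R * R) :=
  `]p.1.1, p.1.2[%classic `*` `]p.2.1, p.2.2[%classic.

Lemma measurable_box p : measurable (box p).
Proof. by apply: measurableX; exact: measurable_itv. Qed.

(** The rational boxes are a countable basis of the plane, so open sets belong
    to the product sigma-algebra. *)
Lemma open_measurable_plane (A : set (R * R)) : open A -> measurable A.
Proof.
move=> oA.
pose B (q : rat * rat * (rat * rat)) : set (R * R) :=
  box ((ratr q.1.1, ratr q.1.2), (ratr q.2.1, ratr q.2.2)).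
have -> : A = \bigcup_(q in [set q | B q `<=` A]) B q.
  apply/seteqP; split=> [[x y] Axy|x [q qA Bx]]; last exact: qA.
  have /nbhs_ballP[e /= e0 eA] : nbhs (x, y) A by exact: open_nbhs_nbhs.
  have near (t : R) : exists q : rat * rat, [/\ t - e < ratr q.1, (ratr q.1 : R) < t,
      t < ratr q.2 & (ratr q.2 : R) < t + e].
    have [|q1] := @rat_in_itvoo R (t - e) t; first by rewrite ltrBlDr ltrDl.
    have [|q2] := @rat_in_itvoo R t (t + e); first by rewrite ltrDl.
    by rewrite !in_itv /= => /andP[? ?] /andP[? ?]; exists (q1, q2).
  have [q [q1 q2 q3 q4]] := near x; have [r [r1 r2 r3 r4]] := near y.
  exists (q, r); last by split; rewrite /= in_itv /= ?q2 ?r2.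
  move=> [x' y'] [] /=; rewrite !in_itv /= => /andP[? ?] /andP[? ?].
  apply: eA; split; rewrite /ball /= ltr_norml; apply/andP; split; lra.
rewrite bigcup_mkcond; apply: countable_bigcupT_measurable => // q.
by case: ifP => _ //; exact: measurable_box.
Qed.

Lemma continuous_measurable_plane (D : set (R * R)) (f : R * R -> R) :
  measurable D -> continuous f -> measurable_fun D f.
Proof.
move=> mD cf; apply: (measurability _ (RGenOpens.measurableE R)).
move=> _ [_ [a [b ->] <-]]; apply: measurableI => //.
apply: open_measurable_plane; move/continuousP : cf; apply; exact: interval_open.
Qed.

Lemma le_enorm (x : R * R) : `|x.1| <= enorm x /\ `|x.2| <= enorm x.
Proof. by split; rewrite -sqrtr_sqr ler_wsqrtr// ?lerDl ?lerDr sqr_ge0. Qed.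

(** Finiteness matters beyond integrability: the area is a real number extracted
    from an extended one, so it would read as 0 if it were infinite. *)
Lemma disc_finite_measure (A : set (R * R)) x0 r :
  measurable A -> A `<=` disc x0 r -> (lebesgue2 A < +oo)%E.
Proof.
move=> mA Ar.
pose p := ((x0.1 - r, x0.1 + r), (x0.2 - r, x0.2 + r)).
have AB : A `<=` box p.
  move=> y /Ar; rewrite /disc /= => yr.
  have [h1 h2] := le_enorm (y - x0).
  split; rewrite /= in_itv /=; apply/andP.
    by have := le_lt_trans h1 yr; rewrite ltr_norml => /andP[] /=; split; lra.
  by have := le_lt_trans h2 yr; rewrite ltr_norml => /andP[] /=; split; lra.
apply: (@le_lt_trans _ _ (lebesgue2 (box p))).
  by apply: le_measure => //; rewrite inE//; exact: measurable_box.
rewrite /lebesgue2 product_measure1E; [|exact: measurable_itv..].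
have itv_lty (a b : R) : (lebesgue_measure (`]a, b[%classic : set R) < +oo)%E.
  by rewrite lebesgue_measure_itv /=; case: ifP => _; rewrite ltry.
apply: lte_mul_pinfty; [exact: measure_ge0| |exact: itv_lty].
by rewrite ge0_fin_numE; [exact: itv_lty|exact: measure_ge0].
Qed.

End PlaneMeasure.

Section BoundedIntegrals.
Context d (T : measurableType d) {R : realType} (mu : {measure set T -> \bar R}).
Implicit Types (A : set T) (f : T -> R).

Lemma bounded_integrable A f B : measurable A -> (mu A < +oo)%E ->
  measurable_fun A f -> (forall x, A x -> 0 <= f x <= B) ->
  mu.-integrable A (EFin \o f).
Proof.
move=> mA Afin mf fB; apply: measurable_bounded_integrable => //.
exists B; split; first exact: num_real.
move=> y By x /fB/andP[f0 fb].
by rewrite /= ger0_norm// (le_trans fb)// ltW.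
Qed.

Lemma Rintegral_le_bound A f B : measurable A -> (mu A < +oo)%E ->
  measurable_fun A f -> (forall x, A x -> 0 <= f x <= B) ->
  \int[mu]_(x in A) f x <= B * fine (mu A).
Proof.
move=> mA Afin mf fB; rewrite -Rintegral_cst//; apply: le_Rintegral => //.
- exact: bounded_integrable fB.
- apply: measurable_bounded_integrable => //.
  exists `|B|; split; first exact: num_real.
  by move=> y By x _ /=; rewrite ltW.
- by move=> x /fB/andP[].
Qed.

End BoundedIntegrals.

Section ArcIntegrals.
Context {R : realType}.
Implicit Types (f : R -> R).

Lemma continuous_integrable01 f : continuous f ->
  (@lebesgue_measure R).-integrable `[0, 1] (EFin \o f).
Proof.
move=> cf; apply: continuous_compact_integrable; first exact: segment_compact.
exact: continuous_subspaceT.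
Qed.

Context (M : mesh R).
Implicit Types (F : face M).

Lemma continuous_curve F : continuous (curve F).
Proof.
move=> t; have [d1 d2 _ _] := curve_C1 F t.
have /differentiable_continuous c1 : differentiable (fun s => (curve F s).1) t.
  exact/derivable1_diffP.
have /differentiable_continuous c2 : differentiable (fun s => (curve F s).2) t.
  exact/derivable1_diffP.
have := cvg_pair c1 c2; rewrite /continuous_at => H.
have -> : curve F = fun s => ((curve F s).1, (curve F s).2).
  by apply/funext => s; case: (curve F s).
exact: H.
Qed.

Lemma continuous_speed F : continuous (speed (curve F)).
Proof.
move=> t; have [_ _ c1 c2] := curve_C1 F t.
have c : {for t, continuous (fun s =>
    (vel (curve F) s).1 ^+ 2 + (vel (curve F) s).2 ^+ 2 : R)}.
  exact: (cvgD (cvgM c1 c1) (cvgM c2 c2)).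
exact: (continuous_comp c (@sqrt_continuous _ _)).
Qed.

Lemma speed_ge0 F t : 0 <= speed (curve F) t.
Proof. exact: sqrtr_ge0. Qed.

Lemma perimeter_ge0 (K : elt M) : 0 <= perimeter K.
Proof.
apply: sumr_ge0 => F _; apply: Rintegral_ge0 => t _.
by rewrite mul1r speed_ge0.
Qed.

Lemma bd_int_le (K : elt M) (f : R * R -> R) B : continuous f ->
  (forall F t, incident F K -> 0 <= t <= 1 -> f (curve F t) <= B) ->
  bd_int K f <= B * perimeter K.
Proof.
move=> cf fB; rewrite /perimeter /bd_int mulr_sumr ler_sum// => F FK.
have cs := @continuous_speed F.
have ci : continuous (fun t => f (curve F t) * speed (curve F) t).
  move=> t; apply: cvgM; last exact: cs.
  by apply: continuous_comp; [exact: continuous_curve|exact: cf].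
rewrite /arc_int -RintegralZl//; last first.
  by apply: continuous_integrable01; under eq_fun do rewrite mul1r.
apply: le_Rintegral => //.
- exact: continuous_integrable01.
- apply: continuous_integrable01 => t; under eq_fun do rewrite mul1r.
  by apply: cvgM; [exact: cvg_cst|exact: cs].
- move=> t; rewrite /= in_itv /= => t01.
  by rewrite mul1r ler_wpM2r ?speed_ge0// fB.
Qed.

Lemma L2_arc_continuous F (f : R * R -> R[i]) : ccontinuous f ->
  L2_arc (curve F) (fun t => f (curve F t)).
Proof.
move=> [f1 f2].
have c1 : continuous (fun t => complex.Re (f (curve F t)) : R).
  by move=> t; exact: (continuous_comp (@continuous_curve F t) (@f1 (curve F t))).
have c2 : continuous (fun t => complex.Im (f (curve F t)) : R).
  by move=> t; exact: (continuous_comp (@continuous_curve F t) (@f2 (curve F t))).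
split.
- exact: measurable_funTS (continuous_measurable_fun c1).
- exact: measurable_funTS (continuous_measurable_fun c2).
- apply: continuous_integrable01 => t; apply: cvgM; last exact: continuous_speed.
  exact: (@continuous_abs2 _ _ (fun t => f (curve F t)) (conj c1 c2)).
Qed.

End ArcIntegrals.

(** * Competitors in the recovered space *)

Section Infimum.
Context {R : realType}.

Lemma inf_sqrt_le {T : Type} (V : set T) (f : T -> R) v :
  V v -> inf [set Num.sqrt (f w) | w in V] <= Num.sqrt (f v).
Proof.
move=> Vv; apply: ge_inf; last by exists v.
by exists 0 => _ [w _ <-]; exact: sqrtr_ge0.
Qed.

End Infimum.

Section TrefftzSpace.
Context {R : realType} (kappa : R) (M : mesh R).
Variables (xK : elt M -> R * R) (V : set (broken M)).
Hypothesis hV : trefftz_space kappa xK V.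

Lemma trefftz_space0 : V (fun _ _ => 0).
Proof.
have [[n [b ->]] _ _] := hV; exists (fun=> 0).
by apply/funext => K; apply/funext => x; rewrite big1// => i _; rewrite mul0r.
Qed.

Lemma trefftz_spaceD (v w : broken M) : V v -> V w ->
  V (fun K x => v K x + w K x).
Proof.
have [[n [b ->]] _ _] := hV => -[a ->] [a' ->]; exists (fun i => a i + a' i).
apply/funext => K; apply/funext => x; rewrite -big_split /=.
by apply: eq_bigr => i _; rewrite mulrDl.
Qed.

Lemma trefftz_spaceZ (a : R[i]) (v : broken M) : V v -> V (fun K x => a * v K x).
Proof.
have [[n [b ->]] _ _] := hV => -[a' ->]; exists (fun i => a * a' i).
apply/funext => K; apply/funext => x; rewrite mulr_sumr.
by apply: eq_bigr => i _; rewrite mulrA.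
Qed.

Lemma trefftz_space_sum (I : Type) (s : seq I) (f : I -> broken M) :
  (forall i, V (f i)) -> V (fun K x => \sum_(i <- s) f i K x).
Proof.
move=> Vf; elim: s => [|i s IH].
  under eq_fun do under eq_fun do rewrite big_nil.
  exact: trefftz_space0.
under eq_fun do under eq_fun do rewrite big_cons.
exact: trefftz_spaceD.
Qed.

(** Each local wave extended by zero is in the space, and so is their linear
    combination over all elements; on a given element only the terms of that
    element survive. *)
Lemma trefftz_space_planewaves (q : elt M -> nat) (c z : forall K, 'I_(q K) -> R[i]) :
  (forall K j, V (fun K' x =>
     if K' == K then planewave kappa (xK K) (z K j) x else 0)) ->
  V (fun K x => \sum_(j < q K) c K j * planewave kappa (xK K) (z K j) x).
Proof.
move=> hpw.
have := trefftz_space_sum (index_enum (elt M)) (fun K =>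
  trefftz_space_sum (index_enum 'I_(q K)) (fun j =>
    trefftz_spaceZ (c K j) (hpw K j))).
congr V; apply/funext => K; apply/funext => x.
rewrite (bigD1 K)//= [X in _ + X]big1 => [|K' KK'].
  by rewrite addr0; apply: eq_bigr => j _; rewrite eqxx.
by rewrite big1// => j _; rewrite eq_sym (negbTE KK') mulr0.
Qed.

End TrefftzSpace.

(** * Estimates on one element *)

Section ElementEstimates.
Context {R : realType} (M : mesh R).
Variables (kappa eta h : R) (K : elt M) (x0 : R * R).
Variables (n : nat) (c z zhat : 'I_n -> R[i]).
Hypothesis kappa_gt0 : 0 < kappa.
Hypothesis ball : elem K `<=` disc x0 h.
Hypotheses (ze : forall j, `|complex.Im (z j)| <= eta)
           (zhate : forall j, `|complex.Im (zhat j)| <= eta).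

Let L : R := l2_sq c * l2_sq (fun j => zhat j - z j).
Let D := D_eta eta.
Let E := E_K kappa eta h.
Let P := P_K kappa eta h.
Let err := pwsum kappa x0 (angle_error c z zhat).
Let B0 := kappa ^+ 2 * D ^+ 2 * E ^+ 2 * h ^+ 2 * L.
Let B1 := kappa ^+ 2 * D ^+ 2 * E ^+ 2 * P * L.

Let abs2_err x : enorm (x - x0) <= h -> abs2 (err x) <= B0.
Proof. exact: abs2_error_le. Qed.

Let vabs2_err x : enorm (x - x0) <= h -> vabs2 (grad err x) <= B1.
Proof. exact: vabs2_grad_error_le. Qed.

Let in_ball x : elem K x -> enorm (x - x0) <= h.
Proof. by move=> /ball; rewrite /disc /= => /ltW. Qed.

Let continuous_err : ccontinuous err.
Proof. exact: ccontinuous_pwsum. Qed.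

Let continuous_abs2_err : continuous (fun x => abs2 (err x)).
Proof. exact: continuous_abs2. Qed.

Let continuous_grad_err : continuous (fun x => vabs2 (grad err x)).
Proof. exact: continuous_vabs2_grad_pwsum. Qed.

Let measurable_elem : measurable (elem K).
Proof. exact: open_measurable_plane (@elem_open _ _ K). Qed.

Let elem_finite : (lebesgue2 (elem K) < +oo)%E.
Proof. exact: disc_finite_measure ball. Qed.

(* The inscribed disc of a shape-regular element makes it nonempty. *)
Let h_gt0 : 0 < h.
Proof.
have [x [r [r0 rK _]]] := elem_shape K.
have : disc x0 h x.
  by apply/ball/rK; rewrite /disc /= subrr /enorm /= expr0n addr0 sqrtr0.
by apply: le_lt_trans; exact: sqrtr_ge0.
Qed.

Let P_ge0 : 0 <= P. Proof. exact: sqr_ge0. Qed.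

(** [C_H1 ^+ 2 * L] is exactly the sum of the pointwise bounds [B0] and [B1] times
    the area; [C_tr] and [C_bd] below have the same structure, with the weights
    [kappa] and [kappa^-1] and with a length in place of the area. *)
Lemma H1_error_le : H1_sq K err <= C_H1 kappa eta h K ^+ 2 * L.
Proof.
have A0 : 0 <= area K by apply: fine_ge0; exact: measure_ge0.
have e : C_H1 kappa eta h K ^+ 2 * L = B0 * area K + B1 * area K.
  rewrite /C_H1 !exprMn (sqr_sqrtr A0) [Num.sqrt (h ^+ 2 + _) ^+ 2]sqr_sqrtr.
    by rewrite /B0 /B1 -/D -/E -/P; ring.
  by rewrite addr_ge0 ?sqr_ge0.
rewrite e /H1_sq; apply: lerD; apply: Rintegral_le_bound => //.
- exact: continuous_measurable_plane.
- by move=> x /in_ball xh; rewrite abs2_ge0 abs2_err.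
- exact: continuous_measurable_plane.
- by move=> x /in_ball xh; rewrite vabs2_ge0 vabs2_err.
Qed.

Let boundary_bound :
  kappa * B0 + kappa^-1 * B1 =
  kappa * D ^+ 2 * E ^+ 2 * ((kappa * h) ^+ 2 + P) * L.
Proof. by rewrite /B0 /B1; field; rewrite gt_eqF. Qed.

Lemma tr_error_le : tr_sq kappa x0 h err <= C_tr kappa eta h ^+ 2 * L.
Proof.
have k0 := ltW kappa_gt0; have h0 := ltW h_gt0.
have e : C_tr kappa eta h ^+ 2 * L =
    (kappa * B0 + kappa^-1 * B1) * h * fine (lebesgue_measure (`[0, 2 * pi] : set R)).
  rewrite lebesgue_measure_itv /= lte_fin mulr_gt0 ?pi_gt0//= oppr0 addr0.
  rewrite boundary_bound /C_tr sqr_sqrtr -/D -/E -/P; first ring.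
  have pi0 := pi_ge0 R.
  apply: mulr_ge0; last by apply: addr_ge0 P_ge0; exact: sqr_ge0.
  do 2 (apply: mulr_ge0; last exact: sqr_ge0).
  by rewrite !mulr_ge0.
pose N (t : R) : R * R := (cos t, sin t).
pose X t := x0 + h *: N t.
have Xh t : enorm (X t - x0) = h.
  rewrite /X addrC addKr /enorm /N /= -[h *: cos t]/(h * cos t).
  rewrite -[h *: sin t]/(h * sin t) !exprMn -mulrDr cos2Dsin2 mulr1.
  by rewrite sqrtr_sqr ger0_norm.
have Xc : continuous X.
  move=> t; apply: cvgD; first exact: cvg_cst.
  apply: cvgZr; exact: cvg_pair (@continuous_cos _ t) (@continuous_sin _ t).
have nN t : Num.sqrt (vabs2 (cvec (N t))) = 1.
  by rewrite vabs2_cvec /enorm /= cos2Dsin2 sqrtr1.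
have cX (f : R * R -> R[i]) : ccontinuous f -> ccontinuous (f \o X).
  by move=> [f1 f2]; split=> s;
    [exact: (continuous_comp (Xc s) (f1 (X s)))
    |exact: (continuous_comp (Xc s) (f2 (X s)))].
have c1 : ccontinuous (fun t => cdot (grad err (X t)) (cvec (N t))).
  under eq_fun do rewrite /err grad_pwsum /cdot /=.
  by apply: ccontinuousD; apply: ccontinuousM;
    [exact: (cX _ (ccontinuous_pwsum _ _ _))
    |exact: (ccontinuous_real (@continuous_cos R))
    |exact: (cX _ (ccontinuous_pwsum _ _ _))
    |exact: (ccontinuous_real (@continuous_sin R))].
have cI : continuous (fun t => (kappa * abs2 (err (X t))
    + kappa^-1 * abs2 (cdot (grad err (X t)) (cvec (N t)))) * h).
  move=> t; apply: cvgM; last exact: cvg_cst.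
  apply: cvgD; apply: cvgM; try exact: cvg_cst.
    exact: (continuous_abs2 (cX _ continuous_err)).
  exact: (continuous_abs2 c1).
rewrite e /tr_sq; apply: Rintegral_le_bound => //.
- exact/compact_finite_measure/segment_compact.
- exact: measurable_funTS (continuous_measurable_fun cI).
- move=> t _; rewrite -/(N t) -/(X t); apply/andP; split.
    by rewrite mulr_ge0// addr_ge0// mulr_ge0 ?invr_ge0 ?abs2_ge0.
  rewrite ler_wpM2r// lerD// ler_wpM2l ?invr_ge0//.
    by rewrite abs2_err// Xh.
  have Xh' : enorm (X t - x0) <= h by rewrite Xh.
  apply: le_trans (vabs2_err Xh').
  have := cdot_cauchy_schwarz (grad err (X t)) (cvec (N t)).
  rewrite nN mulr1 => H; rewrite -sqr_cabs -(sqr_sqrtr (vabs2_ge0 _)).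
  by rewrite lerXn2r ?nnegrE ?cabs_ge0 ?sqrtr_ge0.
Qed.

(** Faces lie in the closure of the element, hence in the closed disc, where the
    pointwise bounds still hold. *)
Lemma curve_in_ball F t : incident F K -> 0 <= t <= 1 -> enorm (curve F t - x0) <= h.
Proof.
move=> FK t01; have : closure (elem K) (curve F t).
  suff: (closure (elem K) `\` elem K) (curve F t) by case.
  by rewrite elem_boundary; exists F => //; exists t => //; rewrite /= in_itv.
pose g (y : R * R) : R := enorm (y - x0).
have cg : continuous g.
  move=> y; have c1 : {for y, continuous (fun w : R * R => (w - x0).1)}.
    by apply: cvgB; [exact: cvg_fst|exact: cvg_cst].
  have c2 : {for y, continuous (fun w : R * R => (w - x0).2)}.
    by apply: cvgB; [exact: cvg_snd|exact: cvg_cst].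
  have c12 : {for y, continuous (fun w : R * R => (w - x0).1 ^+ 2 + (w - x0).2 ^+ 2)}.
    exact: (cvgD (cvgM c1 c1) (cvgM c2 c2)).
  exact: (continuous_comp c12 (@sqrt_continuous _ _)).
have cl : closed [set y | g y <= h].
  by apply: (@preimage_closed _ _ g [set r | r <= h]) => //; exact: closed_le.
move=> H; have /cl : closure [set y | g y <= h] (curve F t).
  by apply: closure_subset H => y /in_ball.
by [].
Qed.

Lemma bd_error_le (v : broken M) : v K = err ->
  bd_sq kappa K (jet v) <= C_bd kappa eta h K ^+ 2 * L.
Proof.
move=> vK; have k0 := ltW kappa_gt0; have p0 := perimeter_ge0 K.
have -> : C_bd kappa eta h K ^+ 2 * L = (kappa * B0 + kappa^-1 * B1) * perimeter K.
  rewrite boundary_bound /C_bd sqr_sqrtr -/D -/E -/P; first ring.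
  apply: mulr_ge0; last by apply: addr_ge0 P_ge0; exact: sqr_ge0.
  do 2 (apply: mulr_ge0; last exact: sqr_ge0).
  by rewrite !mulr_ge0.
rewrite /bd_sq /jet /= vK; apply: bd_int_le.
  move=> x; apply: cvgD.
    by apply: cvgM; [exact: cvg_cst|exact: continuous_abs2_err].
  by apply: cvgM; [exact: cvg_cst|exact: continuous_grad_err].
move=> F t FK t01; have xh := curve_in_ball FK t01.
by rewrite lerD// ler_wpM2l ?invr_ge0 ?abs2_err ?vabs2_err.
Qed.

Lemma error_L2 : lebesgue2.-integrable (elem K)
  (EFin \o (fun x => abs2 (err x) + vabs2 (grad err x))).
Proof.
apply: (@bounded_integrable _ _ _ _ _ _ (B0 + B1)) => //.
  apply: continuous_measurable_plane => // x.
  by apply: cvgD; [exact: continuous_abs2_err|exact: continuous_grad_err].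
move=> x /in_ball xh; rewrite addr_ge0 ?abs2_ge0 ?vabs2_ge0//=.
by rewrite lerD ?abs2_err ?vabs2_err.
Qed.

(** The value of a constant nontangential maximal function of the error. *)
Definition error_sup : R := Num.sqrt B0 + Num.sqrt B1.

Lemma error_le_sup x : elem K x ->
  cabs (err x) + Num.sqrt (vabs2 (grad err x)) <= error_sup.
Proof.
by move=> /in_ball xh; rewrite lerD// ler_wsqrtr ?abs2_err ?vabs2_err.
Qed.

End ElementEstimates.

Section SmoothTraces.
Context {R : realType}.
Variables (kappa : R) (x0 : R * R) (s : seq (R[i] * R[i])).
Let f := pwsum kappa x0 s.

Let vanishing (g : R * R -> R) A x : continuous g -> g x = 0 ->
  g y @[y --> within A (nbhs x)] --> (0 : R).
Proof.
move=> cg <-; apply: cvg_trans (cg x); apply: cvg_app; exact: cvg_within.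
Qed.

(** A sum of plane waves is smooth on the whole plane, so nontangential limits are
    plain continuity, whatever the approach region [A]. *)
Lemma pwsum_trace A x : cabs (f y - f x) @[y --> within A (nbhs x)] --> (0 : R).
Proof.
apply: vanishing; last by rewrite subrr cabs0.
have c : ccontinuous (fun y => f y - f x).
  by apply: ccontinuousD; [exact: ccontinuous_pwsum|exact: ccontinuous_cst].
by move=> y; exact: (continuous_comp (@continuous_abs2 _ _ _ c y) (@sqrt_continuous _ _)).
Qed.

Lemma pwsum_grad_trace A x :
  Num.sqrt (vabs2 (grad f y - grad f x)) @[y --> within A (nbhs x)] --> (0 : R).
Proof.
apply: vanishing; last by rewrite subrr /vabs2 /abs2 /= expr0n !addr0 sqrtr0.
rewrite /f; under eq_fun do rewrite !grad_pwsum.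
set g1 := pwsum _ _ _; set g2 := pwsum _ _ _.
have c (g : R * R -> R[i]) : ccontinuous g ->
    continuous (fun y => abs2 (g y - g x)).
  by move=> cg; apply: continuous_abs2; apply: ccontinuousD => //; exact: ccontinuous_cst.
have c1 := c g1 (ccontinuous_pwsum _ _ _).
have c2 := c g2 (ccontinuous_pwsum _ _ _).
have c12 : continuous (fun y => vabs2 ((g1 y, g2 y) - (g1 x, g2 x))).
  by move=> y; exact: (cvgD (c1 y) (c2 y)).
move=> y.
exact: (continuous_comp (c12 y) (@sqrt_continuous _ _)).
Qed.

Lemma pwsum_L2_arc (M : mesh R) (F : face M) :
  [/\ L2_arc (curve F) (fun t => f (curve F t)),
      L2_arc (curve F) (fun t => (grad f (curve F t)).1) &
      L2_arc (curve F) (fun t => (grad f (curve F t)).2)].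
Proof.
split; [exact: (L2_arc_continuous F (ccontinuous_pwsum _ _ _))|..].
  apply: (@L2_arc_continuous _ _ F (fun x => (grad f x).1)).
  by under eq_fun do rewrite grad_pwsum; exact: ccontinuous_pwsum.
apply: (@L2_arc_continuous _ _ F (fun x => (grad f x).2)).
by under eq_fun do rewrite grad_pwsum; exact: ccontinuous_pwsum.
Qed.

End SmoothTraces.

(** * The error as a piecewise Trefftz function *)

Section BrokenError.
Context {R : realType} (kappa : R) (M : mesh R).
Variables (xK : elt M -> R * R) (hK : elt M -> R) (eta : R).
Variables (q : elt M -> nat) (c z zhat : forall K : elt M, 'I_(q K) -> R[i]).
Hypotheses (kappa_gt0 : 0 < kappa)
  (hball : forall K, elem K `<=` disc (xK K) (hK K))
  (hz : forall K j, `|complex.Im (@z K j)| <= eta)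
  (hzhat : forall K j, `|complex.Im (@zhat K j)| <= eta).

Definition broken_error : broken M := fun K =>
  pwsum kappa (xK K) (angle_error (@c K) (@z K) (@zhat K)).

Lemma broken_error_trefftz : trefftz kappa broken_error.
Proof.
move=> K; have [C1 C2] := pwsum_C2 kappa (xK K) (elem K)
  (angle_error (@c K) (@z K) (@zhat K)).
split; [exact: C1|exact: C2| |].
  by move=> x _; exact: (pwsum_helmholtz kappa (xK K)).
exact: (error_L2 (@c K) kappa_gt0 (@hball K) (@hz K) (@hzhat K)).
Qed.

Lemma broken_error_cauchy_trace : cauchy_trace broken_error (jet broken_error).
Proof.
split=> [K F _|a a0]; first exact: pwsum_L2_arc.
pose sup K := error_sup kappa eta (hK K) (@c K) (@z K) (@zhat K).
exists (fun=> \sum_K sup K) => [K F _|K F _].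
  exact: (L2_arc_continuous F (ccontinuous_cst _)).
apply: aeW => t _; split.
- move=> y [/(error_le_sup (@c K) kappa_gt0 (@hball K) (@hz K) (@hzhat K)) H _].
  rewrite (le_trans H)// (bigD1 K)//= lerDl sumr_ge0// => K' _.
  by rewrite addr_ge0 ?sqrtr_ge0.
- exact: pwsum_trace.
- exact: pwsum_grad_trace.
Qed.

End BrokenError.

(** * The three estimates *)

Theorem theorem5p5 (R : realType) (kappa : R) (M : mesh R)
    (xK : elt M -> R * R) (hK : elt M -> R) (eta : R)
    (q : elt M -> nat) (c z zhat : forall K : elt M, 'I_(q K) -> R[i])
    (u : broken M) (V : set (broken M))
    (hkappa : 0 < kappa)
    (hball : forall K, elem K `<=` disc (xK K) (hK K))
    (hu : forall K x, u K x = \sum_(j < q K) c K j * planewave kappa (xK K) (z K j) x)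
    (hz : forall K j, `|complex.Im (z K j)| <= eta)
    (hzhat : forall K j, `|complex.Im (zhat K j)| <= eta)
    (hV : trefftz_space kappa xK V)
    (hpw : forall K j,
       V (fun K' x => if K' == K then planewave kappa (xK K) (zhat K j) x else 0)) :
  [/\ inf [set Num.sqrt (\sum_K H1_sq K (bsub u v K)) | v in V]
        <= Num.sqrt (\sum_K C_H1 kappa eta (hK K) K ^+ 2 * l2_sq (c K)
                              * l2_sq (fun j => zhat K j - z K j)),
      inf [set Num.sqrt (\sum_K tr_sq kappa (xK K) (hK K) (bsub u v K)) | v in V]
        <= Num.sqrt (\sum_K C_tr kappa eta (hK K) ^+ 2 * l2_sq (c K)
                              * l2_sq (fun j => zhat K j - z K j)) &
      forall (p : flux) (Q : cauchy_data M -> R) (gD gA gR : R * R -> R[i])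
             (uh : broken M) (Cqo Cface : R),
        flux_ok p -> truncation_form Q ->
        boundary_data kappa p u gD gA gR ->
        pwdg_solution kappa p V gD gA gR uh ->
        face_constant kappa p Q Cface ->
        0 <= Cqo ->
        DG_norm kappa p (bsub u uh)
          <= Cqo * inf [set DGplus_norm kappa p Q (bsub u v) | v in V] ->
        DG_norm kappa p (bsub u uh)
          <= Cqo * Num.sqrt Cface
             * Num.sqrt (\sum_K C_bd kappa eta (hK K) K ^+ 2 * l2_sq (c K)
                              * l2_sq (fun j => zhat K j - z K j))].
Proof.
pose v0 : broken M := fun K x =>
  \sum_(j < q K) c K j * planewave kappa (xK K) (zhat K j) x.
have Vv0 : V v0 := trefftz_space_planewaves hV c hpw.
have uv0 : bsub u v0 = broken_error kappa xK c z zhat.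
  by apply/funext => K; apply/funext => x; rewrite /broken_error angle_errorE -hu.
split.
- apply: le_trans (inf_sqrt_le (fun v => \sum_K H1_sq K (bsub u v K)) Vv0) _.
  rewrite uv0 ler_wsqrtr// ler_sum// => K _; rewrite -mulrA.
  exact: H1_error_le.
- apply: le_trans (inf_sqrt_le (fun v =>
    \sum_K tr_sq kappa (xK K) (hK K) (bsub u v K)) Vv0) _.
  rewrite uv0 ler_wsqrtr// ler_sum// => K _; rewrite -mulrA.
  exact: tr_error_le (hball K) _ _.
- move=> p Q gD gA gR uh Cqo Cface _ _ _ _ [Cface0 face] Cqo0 quasi_opt.
  apply: le_trans quasi_opt _; rewrite -mulrA ler_wpM2l//.
  apply: le_trans (inf_sqrt_le (fun v =>
    DGplus_sq kappa p Q (jet (bsub u v))) Vv0) _.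
  rewrite uv0 -sqrtrM// ler_wsqrtr//.
  have Tr := broken_error_trefftz c hkappa hball hz hzhat.
  have Ct := broken_error_cauchy_trace c hkappa hball hz hzhat.
  apply: le_trans (face _ _ Tr Ct) _.
  rewrite ler_wpM2l// ler_sum// => K _; rewrite -mulrA.
  exact: bd_error_le.
Qed.
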